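(* Let $\Omega\subseteq\mathbb{C}$ be a domain and let $f:\Omega\to\mathbb{C}$ be a continuous function. Then $f$ is of class $C^1(\Omega)$ and holomorphic in $\Omega$ if and only if $$f(z)=\frac1{|D_r(z)|}\int_{D_r(z)} f(\zeta)\left[1+\frac{2}{r}\,(\zeta-z)\right] dA_\zeta$$ for any disk $D_r(z)$ with $\overline{D_r(z)}\subset\Omega$.
   Context: $D_r(z)$ denotes the disk in $\mathbb{C}$ centered at $z$ with radius $r>0$, $|D_r(z)|=\pi r^2$ its area, and $dA_\zeta$ the area (Lebesgue) element on $\mathbb{C}\cong\mathbb{R}^2$. The formula is required for all $z\in\Omega$ and all $r>0$ with $\overline{D_r(z)}\subset\Omega$. *)

(* Defs.v *)
From HB Require Import structures.
From mathcomp Require Import all_boot all_order all_algebra.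
From mathcomp Require Import complex.
From mathcomp Require Import all_classical all_reals all_analysis.

Set Implicit Arguments.
Unset Strict Implicit.
Unset Printing Implicit Defensive.

Import Order.TTheory GRing.Theory Num.Theory.
Import numFieldNormedType.Exports.

Local Open Scope classical_set_scope.
Local Open Scope ring_scope.
Local Open Scope complex_scope.

(* [R[i]^o] is the complex plane with its metric topology and its structure of
   normed space over the field [R[i]]; [ball], [derivable] and so on over it
   take their radii and scalars in [R[i]]. *)

Definition domain (R : realType) (Omega : set R[i]^o) : Prop :=
  [/\ open Omega, connected Omega & Omega !=set0].

Definition disk (R : realType) (z : R[i]^o) (r : R) : set R[i]^o :=
  ball z r%:C.

Definition plane_to_C (R : realType) (p : R * R) : R[i]^o := p.1 +i* p.2.

(* Complex differentiability: the increment and the direction [1] are taken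
   over the field [R[i]]. *)
Definition holomorphic_in (R : realType) (Omega : set R[i]^o)
    (f : R[i]^o -> R[i]^o) : Prop :=
  forall z, Omega z -> derivable f z 1.

Definition C1_plane (R : realType) (U : set (R * R)) (g : R * R -> R) : Prop :=
  forall v : R * R, v = (1, 0) \/ v = (0, 1) ->
    (forall p, U p -> derivable g p v) /\
    {within U, continuous (fun p => 'D_v g p)}.

(* Class C^1 in the real sense: the real and imaginary parts have continuous
   first-order partial derivatives in the real coordinates x, y. *)
Definition C1_in (R : realType) (Omega : set R[i]^o)
    (f : R[i]^o -> R[i]^o) : Prop :=
  C1_plane (@plane_to_C R @^-1` Omega) (fun p => complex.Re (f (plane_to_C p))) /\
  C1_plane (@plane_to_C R @^-1` Omega) (fun p => complex.Im (f (plane_to_C p))).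

(* Two-dimensional Lebesgue measure, in the real coordinates x, y. *)
Definition area_measure (R : realType) : {measure set (measurableTypeR R * measurableTypeR R) -> \bar R} :=
  (@lebesgue_measure R \x @lebesgue_measure R)%E.

Definition area (R : realType) (A : set R[i]^o) : R :=
  fine (area_measure R (@plane_to_C R @^-1` A)).

Definition area_integral (R : realType) (A : set R[i]^o)
    (f : R[i]^o -> R[i]^o) : R[i]^o :=
  (\int[area_measure R]_(p in @plane_to_C R @^-1` A)
     complex.Re (f (plane_to_C p))) +i*
  (\int[area_measure R]_(p in @plane_to_C R @^-1` A)
     complex.Im (f (plane_to_C p))).

(* Main.v *)
Require Import Defs.
From HB Require Import structures.
From mathcomp Require Import all_boot all_order all_algebra.
From mathcomp Require Import complex.
From mathcomp Require Import all_classical all_reals all_analysis.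
From mathcomp Require Import measurable_realfun ring lra.

Set Implicit Arguments.
Unset Strict Implicit.
Unset Printing Implicit Defensive.

Import Order.TTheory GRing.Theory Num.Theory.
Import numFieldNormedType.Exports.

Local Open Scope classical_set_scope.
Local Open Scope ring_scope.

(** The statement is reduced to real variables: [C] is identified with [R * R],
    [f = a + i b], and integrals over disks are computed by Fubini's theorem
    along chords.  The basic tool is an elementary divergence theorem: if [g]
    vanishes on the circle then its partial derivatives have integral 0 over the
    disk ([dskint_deriv_fst], [dskint_deriv_snd]).

    Direct implication.  Take the disk of centre 0 and radius [r], and let
    [T = r^2 - |w|^2].  If [f] is holomorphic then [- w f] is the derivative of
    [T f] with respect to the conjugate variable, so that the integral of [w f]
    is 0 ([CR_pair_moment]).  In the same way, the derivative of
    [T^(n+1) conj(w) f] shows that the integral of [(n+1) (T/r^2)^n f] does not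
    depend on [n] ([CR_pair_weight]).  These weights form an approximate
    identity at the centre, whence the mean value property of [f]
    ([CR_pair_mean]).  Only first derivatives of [f] are used, and no rotation
    invariance of the area.

    Converse.  The integral of a continuous function over a disk of fixed radius
    is a C^1 function of the centre: its partial derivatives are integrals of
    the differences of the values at the endpoints of the chords
    ([dskint_has_partials]).  The formula expresses [f] through such integrals,
    so [f] is C^1 ([mean_formula_regular]).  Then [f] is differentiable at each
    [z] in the real sense.  Its linearisation at [z] is the sum of a holomorphic
    part, which satisfies the formula by the direct implication, and of
    [k conj(zeta - z)], which contributes [k r] to the right-hand side, while
    the remainder contributes [o(r)].  Hence [k = 0], which is the
    Cauchy-Riemann equation ([mean_formula_CR]). *)

(** * Measurability and integration on the plane *)

Section plane.
Context {R : realType}.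
Local Notation mu2 := (@area_measure R).
Local Notation R2 := (measurableTypeR R * measurableTypeR R)%type.

Lemma open_measurable_prod (A : set (R * R)) : open A -> measurable (A : set R2).
Proof.
move=> oA.
pose B (t : rat * rat * nat) : set (R * R) :=
  ball (ratr t.1.1 : R, ratr t.1.2 : R) (t.2.+1%:R^-1).
have -> : A = \bigcup_(t in [set t | B t `<=` A]) B t.
  apply/seteqP; split => [[x y] Axy|p [t /= BA Bp]]; last exact: BA.
  have /nbhs_ballP[e /= e0 eA] : nbhs (x, y) A by exact: open_nbhs_nbhs.
  have e20 : 0 < e / 2 by rewrite divr_gt0.
  have [n ne] : exists n : nat, n.+1%:R^-1 < e / 2 :> R.
    have [N _ /(_ N (leqnn N)) /= ?] := near_infty_natSinv_lt (PosNum e20).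
    by exists N.
  have : 0 < n.+1%:R^-1 :> R by rewrite invr_gt0 ltr0n.
  pose B' d (q : rat * rat) : set (R * R) := ball (ratr q.1 : R, ratr q.2 : R) d.
  suff : forall d : R, d < e / 2 -> 0 < d ->
      exists q, B' d q (x, y) /\ B' d q `<=` A.
    by move=> /(_ _ ne) H /H [q [qxy qA]]; exists (q, n).
  move=> d de d0.
  have [q1] : exists q, ratr q \in `]x - d, x + d[ by apply: rat_in_itvoo; lra.
  rewrite in_itv/= => /andP[q1l q1u].
  have [q2] : exists q, ratr q \in `]y - d, y + d[ by apply: rat_in_itvoo; lra.
  rewrite in_itv/= => /andP[q2l q2u].
  have Bxy : B' d (q1, q2) (x, y).
    by split; rewrite /= /ball/= ltr_norml; apply/andP; split; lra.
  exists (q1, q2); split => // z Bz; apply: eA.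
  apply: (@le_ball _ _ _ (d + d)); first by lra.
  exact: ball_triangle (ball_sym Bxy) Bz.
rewrite bigcup_mkcond; apply: countable_bigcupT_measurable => // t.
case: ifPn => // _.
have -> : (B t : set R2) = ball (ratr t.1.1 : R) (t.2.+1%:R^-1)
  `*` ball (ratr t.1.2 : R) (t.2.+1%:R^-1) by [].
by apply: measurableX; apply: open_measurable; exact: ball_open.
Qed.

Lemma continuous_measurable_fun_prod (g : R * R -> R) :
  continuous g -> measurable_fun setT (g : R2 -> R).
Proof.
move=> /continuousP cg; apply: (measurability _ (RGenOpens.measurableE R)).
move=> _ [_ [a [b ->] <-]]; rewrite setTI; apply: open_measurable_prod.
exact/cg/interval_open.
Qed.

(** Square of the Euclidean distance; the canonical norm of [R * R] is the
    maximum norm, so that Euclidean disks have to be defined. *)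
Definition sqdist (p q : R * R) : R := (q.1 - p.1) ^+ 2 + (q.2 - p.2) ^+ 2.

(** Open and closed Euclidean disks. *)
Definition dsk (p : R * R) (r : R) : set (R * R) := [set q | sqdist p q < r ^+ 2].
Definition cdsk (p : R * R) (r : R) : set (R * R) := [set q | sqdist p q <= r ^+ 2].

Lemma continuous_fst_pt (q : R * R) : {for q, continuous (fun q : R * R => q.1)}.
Proof. exact: cvg_fst. Qed.

Lemma continuous_snd_pt (q : R * R) : {for q, continuous (fun q : R * R => q.2)}.
Proof. exact: cvg_snd. Qed.

Lemma continuous_sqdist p : continuous (sqdist p).
Proof.
move=> q; rewrite /sqdist.
apply: (@continuousD _ _ _ (fun q => (q.1 - p.1) ^+ 2)
   (fun q => (q.2 - p.2) ^+ 2)).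
- apply: (@continuous_comp _ _ _ (fun q : R * R => q.1 - p.1) (fun x => x ^+ 2)).
    by apply: continuousB; [exact: cvg_fst|exact: cvg_cst].
  exact: exprn_continuous.
- apply: (@continuous_comp _ _ _ (fun q : R * R => q.2 - p.2) (fun x => x ^+ 2)).
    by apply: continuousB; [exact: cvg_snd|exact: cvg_cst].
  exact: exprn_continuous.
Qed.

Lemma open_dsk p r : open (dsk p r).
Proof.
apply: ((continuousP (sqdist p)).1 (@continuous_sqdist p) [set x | x < r ^+ 2]).
exact: open_lt.
Qed.

Lemma measurable_dsk p r : measurable (dsk p r : set R2).
Proof. by apply: open_measurable_prod; exact: open_dsk. Qed.

Lemma dsk_cdsk p r : dsk p r `<=` cdsk p r.
Proof. by move=> q /ltW. Qed.

Lemma cdsk_bound p r q : 0 <= r -> cdsk p r q ->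
  (`|q.1 - p.1| <= r) /\ (`|q.2 - p.2| <= r).
Proof.
move=> r0 pq; split; rewrite -(@ler_pXn2r _ 2) ?nnegrE// real_normK ?num_real//.
  by apply: le_trans pq; rewrite lerDl sqr_ge0.
by apply: le_trans pq; rewrite lerDr sqr_ge0.
Qed.

(** Closed square circumscribed about a disk. *)
Definition box (p : R * R) (r : R) : set (R * R) :=
  `[p.1 - r, p.1 + r]%classic `*` `[p.2 - r, p.2 + r]%classic.

Lemma cdsk_box p r : 0 <= r -> cdsk p r `<=` box p r.
Proof.
move=> r0 q /(cdsk_bound r0)[]; rewrite !ler_norml => /andP[? ?] /andP[? ?].
by split; rewrite /= in_itv/=; apply/andP; split; lra.
Qed.

Lemma compact_box p r : compact (box p r).
Proof. by apply: compact_setX; exact: segment_compact. Qed.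

Lemma area_dsk_lty p r : 0 <= r -> (mu2 (dsk p r) < +oo)%E.
Proof.
move=> r0.
have mB : measurable (box p r : set R2).
  by apply: measurableX; exact: measurable_itv.
apply: (@le_lt_trans _ _ (mu2 (box p r))).
  apply: le_measure; rewrite ?inE//; first exact: measurable_dsk.
  exact: subset_trans (@dsk_cdsk _ _) (cdsk_box r0).
rewrite /area_measure/= product_measure1E; try exact: measurable_itv.
rewrite [X in (X * _)%E](lebesgue_measure_itv `[p.1 - r, p.1 + r]).
rewrite [X in (_ * X)%E](lebesgue_measure_itv `[p.2 - r, p.2 + r])/=.
by do 2 case: ifP => _; rewrite ?mule0 ?mul0e// -EFinM ltry.
Qed.

Lemma continuous_bounded_box (g : R * R -> R) p r : continuous g ->
  exists2 M, 0 <= M & forall q, box p r q -> `|g q| <= M.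
Proof.
move=> cg.
have cpt : compact (g @` box p r).
  apply: continuous_compact; last exact: compact_box.
  exact: continuous_subspaceT.
have [M [Mreal MP]] := compact_bounded cpt.
exists (`|M| + 1) => [|q Bq]; first by rewrite addr_ge0.
apply: (MP (`|M| + 1)) => //; first by rewrite ltr_pwDr// ler_norm.
Qed.

Lemma integrable_dsk_continuous p r (g : R * R -> R) : 0 <= r -> continuous g ->
  mu2.-integrable (dsk p r : set R2) (EFin \o g).
Proof.
move=> r0 cg; apply: measurable_bounded_integrable.
- exact: measurable_dsk.
- exact: area_dsk_lty.
- apply: (@measurable_funS _ _ _ _ setT) => //.
  exact: continuous_measurable_fun_prod.
- have [M M0 gM] := @continuous_bounded_box g p r cg.
  exists M; split; first by rewrite num_real.
  move=> x Mx q Dq; apply: le_trans (ltW Mx); apply: gM.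
  exact/(cdsk_box r0)/dsk_cdsk.
Qed.

(** Radial projection of the plane onto the closed disk. *)
Definition retract (p : R * R) (r : R) (q : R * R) : R * R :=
  let c := r / Num.max r (Num.sqrt (sqdist p q)) in
  (p.1 + c * (q.1 - p.1), p.2 + c * (q.2 - p.2)).

Lemma sqdist_ge0 p q : 0 <= sqdist p q.
Proof. by rewrite addr_ge0 ?sqr_ge0. Qed.

Lemma retract_id p r q : 0 < r -> cdsk p r q -> retract p r q = q.
Proof.
move=> r0 pq; rewrite /retract.
have le_sr : Num.sqrt (sqdist p q) <= r.
  rewrite -(@ler_pXn2r _ 2) ?nnegrE ?sqrtr_ge0 ?(ltW r0)//.
  by rewrite sqr_sqrtr ?sqdist_ge0.
rewrite (max_idPl le_sr) divff ?gt_eqF// !mul1r; case: q {pq le_sr} => x y /=.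
by congr pair; ring.
Qed.

Lemma retract_cdsk p r q : 0 < r -> cdsk p r (retract p r q).
Proof.
move=> r0; rewrite /cdsk /retract/=; set m := Num.max _ _.
have m0 : 0 < m by rewrite lt_max r0.
rewrite {1}/sqdist /=.
have -> : (p.1 + r / m * (q.1 - p.1) - p.1) ^+ 2 +
  (p.2 + r / m * (q.2 - p.2) - p.2) ^+ 2 = (r / m) ^+ 2 * sqdist p q.
  by rewrite /sqdist; ring.
rewrite expr_div_n mulrAC ler_pdivrMr ?exprn_gt0// ler_wpM2l ?sqr_ge0//.
rewrite -[leLHS]sqr_sqrtr ?sqdist_ge0// ler_pXn2r ?nnegrE ?sqrtr_ge0 ?(ltW m0)//.
by rewrite le_max lexx orbT.
Qed.

Lemma continuous_pair_pt (T U V : topologicalType) (f : T -> U) (g : T -> V) (t : T) :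
  {for t, continuous f} -> {for t, continuous g} ->
  {for t, continuous (fun u => (f u, g u))}.
Proof. by move=> cf cg; exact: (cvg_pair cf cg). Qed.

Lemma continuous_retract p r : 0 < r -> continuous (retract p r).
Proof.
move=> r0 q.
have cc : {for q, continuous (fun q => r / Num.max r (Num.sqrt (sqdist p q)))}.
  apply: continuousM; first exact: cvg_cst.
  apply: continuousV; first by rewrite gt_eqF// lt_max r0.
  apply: continuous_max; first exact: cvg_cst.
  apply: (@continuous_comp _ _ _ (sqdist p) Num.sqrt).
    exact: continuous_sqdist.
  exact: sqrt_continuous.
pose c q := r / Num.max r (Num.sqrt (sqdist p q)).
have aux (u : R * R -> R) (v : R) : {for q, continuous u} ->
    {for q, continuous (fun q => v + c q * (u q - v))}.
  move=> cu; apply: continuousD; first exact: cvg_cst.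
  by apply: continuousM => //; apply: continuousB => //; exact: cvg_cst.
exact: (continuous_pair_pt (aux _ p.1 (continuous_fst_pt (q:=q)))
  (aux _ p.2 (continuous_snd_pt (q:=q)))).
Qed.

(** Continuity at each point of [U], as a function on the whole plane; for an
    open [U] this is the continuity of the restriction to [U]. *)
Definition cont_on (U : set (R * R)) (g : R * R -> R) :=
  forall q, U q -> {for q, continuous g}.

(** Continuous functions near a closed disk may be replaced, in integrals over
    the disk, by functions continuous on the whole plane. *)
Lemma continuous_extension p r (g : R * R -> R) : 0 < r ->
  cont_on (cdsk p r) g ->
  exists2 h, continuous h & forall q, cdsk p r q -> h q = g q.
Proof.
move=> r0 cg; exists (g \o retract p r) => [q|q pq /=]; last by rewrite retract_id.
apply: continuous_comp; first exact: continuous_retract.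
exact/cg/retract_cdsk.
Qed.

End plane.

(** * Slicing a disk *)

Section slices.
Context {R : realType}.
Local Notation mu := (@lebesgue_measure R).
Local Notation mu2 := (@area_measure R).
Local Notation R2 := (measurableTypeR R * measurableTypeR R)%type.
Implicit Types (p q : R * R) (g h : R * R -> R).

(** Integral over the open disk of centre [p] and radius [r]. *)
Definition dskint p r g : R := \int[mu2]_(q in (dsk p r : set R2)) g q.

(** Half-length of the chord of abscissa [x]; the square root of a negative
    number being 0, the chord degenerates to a point away from the disk. *)
Definition hchord p (r x : R) : R := Num.sqrt (r ^+ 2 - (x - p.1) ^+ 2).

Lemma hchord_ge0 p r x : 0 <= hchord p r x.
Proof. exact: sqrtr_ge0. Qed.

Lemma dsk_section p r x y :
  dsk p r (x, y) <-> y \in `]p.2 - hchord p r x, p.2 + hchord p r x[.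
Proof.
rewrite in_itv/= /dsk/= /sqdist/= /hchord.
have -> : (p.2 - Num.sqrt (r ^+ 2 - (x - p.1) ^+ 2) < y <
   p.2 + Num.sqrt (r ^+ 2 - (x - p.1) ^+ 2)) =
   (`|y - p.2| < Num.sqrt (r ^+ 2 - (x - p.1) ^+ 2)).
  by rewrite ltr_norml; apply/andP/andP => -[? ?]; split; lra.
rewrite -sqrtr_sqr; have [r0|r0] := ltP 0 (r ^+ 2 - (x - p.1) ^+ 2).
  by rewrite ltr_sqrt//; split; lra.
rewrite (ler0_sqrtr r0); split; last by rewrite ltNge sqrtr_ge0.
by have := sqr_ge0 (y - p.2); lra.
Qed.

Lemma cdsk_section p r x y : 0 <= r ^+ 2 - (x - p.1) ^+ 2 ->
  y \in `[p.2 - hchord p r x, p.2 + hchord p r x] -> cdsk p r (x, y).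
Proof.
move=> r0; rewrite in_itv/= /cdsk/= /sqdist/= => /andP[y1 y2].
rewrite -lerBrDl -(sqr_sqrtr r0) -/(hchord p r x).
rewrite -(real_normK (num_real (y - p.2))) ler_pXn2r ?nnegrE ?hchord_ge0//.
by rewrite ler_norml; apply/andP; split; lra.
Qed.

(** Integral along the vertical chord of abscissa [x]. *)
Definition chordint p r g x : R :=
  \int[mu]_(y in `[p.2 - hchord p r x, p.2 + hchord p r x]) g (x, y).

Lemma continuous_section g x : continuous g -> continuous (fun y => g (x, y)).
Proof.
move=> cg y; apply: (@continuous_comp _ _ _ (fun y => (x, y)) g); last exact: cg.
by apply: continuous_pair_pt; [exact: cvg_cst|exact: cvg_id].
Qed.

Lemma integrable_section g x a b : continuous g ->
  mu.-integrable `[a, b] (EFin \o (fun y => g (x, y))).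
Proof.
move=> cg; apply: continuous_compact_integrable; first exact: segment_compact.
exact/continuous_subspaceT/continuous_section.
Qed.

(** Fubini's theorem on a disk. *)
Lemma slice p r g : 0 <= r -> continuous g ->
  mu.-integrable setT (EFin \o chordint p r g) /\
  dskint p r g = \int[mu]_x chordint p r g x.
Proof.
move=> r0 cg.
have ig : mu2.-integrable setT (EFin \o (g \_ (dsk p r))).
  rewrite -restrict_EFin; apply: (integrable_mkcond _ (measurable_dsk _ _)).1.
  exact: integrable_dsk_continuous.
have FE : fubini_F mu (EFin \o (g \_ (dsk p r))) = EFin \o chordint p r g.
  apply/funext => x; rewrite /fubini_F /=.
  rewrite /chordint /Rintegral fineK; last first.
    by apply: integrable_fin_num => //; exact: integrable_section.
  rewrite integral_itv_bndoo; last first.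
    apply: measurable_funS (measurable_int _ (@integrable_section g x
      (p.2 - hchord p r x) (p.2 + hchord p r x) cg)) => //.
    exact: subset_itv_oo_cc.
  rewrite [RHS]integral_mkcond; apply: eq_integral => y _.
  rewrite restrict_EFin /= /patch; case: ifPn; case: ifPn => //.
  - by move=> /negP yI /[!inE] /dsk_section; rewrite inE in yI.
  - by rewrite inE => /dsk_section yI /negP; rewrite inE.
split; first by rewrite -FE; exact: integrable_fubini_F.
rewrite /dskint Rintegral_mkcond /Rintegral -[X in _ = fine X]/(\int[mu]_x (EFin \o chordint p r g) x)%E.
by rewrite -FE integral12_prod_meas1.
Qed.

(** Symmetry with respect to the diagonal, which transfers to the first
    variable what is proved for the second one. *)
Definition swap (q : R * R) : R * R := (q.2, q.1).

Lemma continuous_swap : continuous swap.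
Proof. by move=> q; apply: continuous_pair_pt; [exact: cvg_snd|exact: cvg_fst]. Qed.

Lemma sqdist_swap p q : sqdist (swap p) (swap q) = sqdist p q.
Proof. by rewrite /sqdist addrC. Qed.

Lemma dskint_swap p r g : 0 <= r -> continuous g ->
  dskint p r g = dskint (swap p) r (g \o swap).
Proof.
move=> r0 cg.
have intp p' g' : continuous g' ->
    mu2.-integrable setT (EFin \o (g' \_ (dsk p' r))).
  move=> cg'.
  rewrite -restrict_EFin; apply: (integrable_mkcond _ (measurable_dsk _ _)).1.
  exact: integrable_dsk_continuous.
have cgs : continuous (g \o swap).
  by move=> q; apply: continuous_comp; [exact: continuous_swap|exact: cg].
rewrite /dskint Rintegral_mkcond [RHS]Rintegral_mkcond /Rintegral; congr fine.
rewrite -(integral12_prod_meas1 (intp _ _ cg)) -(integral21_prod_meas1 (intp _ _ cgs)).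
apply: eq_integral => x _; apply: eq_integral => y _ /=; congr EFin.
rewrite /patch; suff -> : ((x, y) \in dsk p r) = ((y, x) \in dsk (swap p) r) by [].
by apply/idP/idP; rewrite !inE /dsk/= -(sqdist_swap p (x, y)).
Qed.

End slices.

(** * Integrals over disks *)

Section disk_integrals.
Context {R : realType}.
Local Notation mu2 := (@area_measure R).
Local Notation R2 := (measurableTypeR R * measurableTypeR R)%type.
Implicit Types (p q : R * R) (g h : R * R -> R).

Lemma eq_dskint p r g h : (forall q, dsk p r q -> g q = h q) ->
  dskint p r g = dskint p r h.
Proof. by move=> gh; apply: eq_Rintegral => q /[!inE]; exact: gh. Qed.

Lemma integrable_dsk p r g : 0 < r -> cont_on (cdsk p r) g ->
  mu2.-integrable (dsk p r : set R2) (EFin \o g).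
Proof.
move=> r0 cg; have [h ch gh] := continuous_extension r0 cg.
have ih := @integrable_dsk_continuous _ p r h (ltW r0) ch.
apply: eq_integrable ih; first exact: measurable_dsk.
by move=> q /[!inE] /dsk_cdsk pq /=; rewrite gh.
Qed.

Lemma dskintD p r g h : 0 < r -> cont_on (cdsk p r) g -> cont_on (cdsk p r) h ->
  dskint p r (fun q => g q + h q) = dskint p r g + dskint p r h.
Proof.
move=> r0 cg ch; apply: RintegralD; first exact: measurable_dsk.
- exact: integrable_dsk.
- exact: integrable_dsk.
Qed.

Lemma dskintB p r g h : 0 < r -> cont_on (cdsk p r) g -> cont_on (cdsk p r) h ->
  dskint p r (fun q => g q - h q) = dskint p r g - dskint p r h.
Proof.
move=> r0 cg ch; apply: RintegralB; first exact: measurable_dsk.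
- exact: integrable_dsk.
- exact: integrable_dsk.
Qed.

Lemma dskintZ p r g c : 0 < r -> cont_on (cdsk p r) g ->
  dskint p r (fun q => c * g q) = c * dskint p r g.
Proof.
move=> r0 cg; apply: RintegralZl; first exact: measurable_dsk.
exact: integrable_dsk.
Qed.

Lemma le_dskint p r g h : 0 < r -> cont_on (cdsk p r) g -> cont_on (cdsk p r) h ->
  (forall q, dsk p r q -> g q <= h q) -> dskint p r g <= dskint p r h.
Proof.
move=> r0 cg ch gh; apply: le_Rintegral => //; first exact: measurable_dsk.
- exact: integrable_dsk.
- exact: integrable_dsk.
Qed.

Lemma le_norm_dskint p r g h : 0 < r ->
  cont_on (cdsk p r) g -> cont_on (cdsk p r) h ->
  (forall q, dsk p r q -> `|g q| <= h q) -> `|dskint p r g| <= dskint p r h.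
Proof.
move=> r0 cg ch gh.
have := @le_normr_Rintegral _ _ _ mu2 _ _ (measurable_dsk p r)
  (integrable_dsk r0 cg).
move=> /le_trans; apply; apply: (@le_dskint _ _ (fun q => `|g q|)) => //.
by move=> q pq; apply: (@continuous_comp _ _ _ g Num.norm);
  [exact: cg|exact: norm_continuous].
Qed.

Lemma chordint_eq0 p r g x : r ^+ 2 - (x - p.1) ^+ 2 <= 0 -> chordint p r g x = 0.
Proof.
move=> r0; rewrite /chordint /hchord ler0_sqrtr// subr0 addr0.
by rewrite set_itv1 Rintegral_set1.
Qed.

Lemma is_derive_continuous (f : R -> R) (x df : R) :
  is_derive x 1 f df -> {for x, continuous f}.
Proof. by case=> fx _; exact/differentiable_continuous/derivable1_diffP. Qed.

(** Divergence theorem on a disk for a vertical field vanishing on the circle. *)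
Lemma dskint_deriv_snd p r g g' : 0 < r -> cont_on (cdsk p r) g' ->
  (forall q, cdsk p r q -> is_derive q.2 1 (fun y => g (q.1, y)) (g' q)) ->
  (forall q, sqdist p q = r ^+ 2 -> g q = 0) ->
  dskint p r g' = 0.
Proof.
move=> r0 cg' dg g0; have [h ch hg] := continuous_extension r0 cg'.
rewrite (@eq_dskint _ _ _ h); last by move=> q /dsk_cdsk /hg.
have [_ ->] := @slice _ p r h (ltW r0) ch.
under eq_Rintegral => x _.
  have -> : chordint p r h x = 0.
    have [?|x0] := leP (r ^+ 2 - (x - p.1) ^+ 2) 0; first exact: chordint_eq0.
    have s0 : 0 < hchord p r x by rewrite sqrtr_gt0.
    have s2 : hchord p r x ^+ 2 = r ^+ 2 - (x - p.1) ^+ 2 by rewrite sqr_sqrtr ?ltW.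
    rewrite /chordint; set a := p.2 - _; set b := p.2 + _.
    have ab : a < b by rewrite /a /b; lra.
    have ga : g (x, a) = 0 by apply: g0; rewrite /sqdist /= /a; lra.
    have gb : g (x, b) = 0 by apply: g0; rewrite /sqdist /= /b; lra.
    have dab y : y \in `[a, b] -> is_derive y 1 (fun y => g (x, y)) (h (x, y)).
      by move=> yab; have pxy := cdsk_section (ltW x0) yab; rewrite hg//; exact: (dg _ pxy).
    rewrite /Rintegral (@continuous_FTC2 _ _ (fun y => g (x, y)) _ _ ab).
    - by rewrite ga gb /= subrr.
    - exact/continuous_subspaceT/continuous_section.
    - split.
      + by move=> y yab; have [] := dab y (subset_itv_oo_cc yab).
      + apply: cvg_at_right_filter; apply: (is_derive_continuous (dab a _)).
        by rewrite in_itv/= lexx ltW.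
      + apply: (@cvg_at_left_filter _ _ (fun y => g (x, y))).
        by apply: (is_derive_continuous (dab b _)); rewrite in_itv/= lexx ltW.
    - by move=> y yab; have [_ <-] := dab y (subset_itv_oo_cc yab); rewrite derive1E.
  over.
by rewrite Rintegral_cst// mul0r.
Qed.

Lemma cont_on_swap p r g : cont_on (cdsk p r) g -> cont_on (cdsk (swap p) r) (g \o swap).
Proof.
move=> cg q pq; apply: continuous_comp; first exact: continuous_swap.
by apply: cg; rewrite /cdsk/= -sqdist_swap.
Qed.

Lemma dskint_swap_on p r g : 0 < r -> cont_on (cdsk p r) g ->
  dskint p r g = dskint (swap p) r (g \o swap).
Proof.
move=> r0 cg; have [h ch hg] := continuous_extension r0 cg.
rewrite (@eq_dskint _ _ _ h); last by move=> q /dsk_cdsk /hg.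
rewrite dskint_swap ?ltW//; apply: eq_dskint => q /dsk_cdsk pq /=.
by apply: hg; rewrite /cdsk/= -sqdist_swap.
Qed.

Lemma dskint_deriv_fst p r g g' : 0 < r -> cont_on (cdsk p r) g' ->
  (forall q, cdsk p r q -> is_derive q.1 1 (fun x => g (x, q.2)) (g' q)) ->
  (forall q, sqdist p q = r ^+ 2 -> g q = 0) ->
  dskint p r g' = 0.
Proof.
move=> r0 cg' dg g0; rewrite dskint_swap_on//.
apply: (@dskint_deriv_snd _ _ (g \o swap)) => //.
- exact: cont_on_swap.
- by move=> q pq; apply: (dg (swap q)); rewrite /cdsk/= -sqdist_swap.
- by move=> q pq; apply: g0; rewrite -sqdist_swap.
Qed.

End disk_integrals.

(** * Dependence of disk integrals on the centre *)

Section moving_disk.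
Context {R : realType}.
Local Notation mu := (@lebesgue_measure R).
Implicit Types (p q : R * R) (g h : R * R -> R).

Lemma integrable_itv (f : R -> R) a b : continuous f ->
  mu.-integrable `[a, b] (EFin \o f).
Proof.
move=> cf; apply: continuous_compact_integrable; first exact: segment_compact.
exact/continuous_subspaceT.
Qed.

Lemma Rintegral_itv_sub (f : R -> R) c a b : continuous f -> c <= a -> a <= b ->
  \int[mu]_(y in `[a, b]) f y =
  \int[mu]_(y in `[c, b]) f y - \int[mu]_(y in `[c, a]) f y.
Proof.
move=> cf ca ab.
rewrite (@Rintegral_itvB _ _ (BLeft c) (BRight b)) ?bnd_simp//.
  rewrite Rintegral_itv_obnd_cbnd//.
  apply: integrableS (@integrable_itv f a b cf) => //.
  exact: subset_itv_oc_cc.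
exact: integrable_itv.
Qed.

Lemma is_derive_chord (f : R -> R) (s y : R) : continuous f -> 0 <= s ->
  is_derive y 1 (fun t => \int[mu]_(u in `[t - s, t + s]) f u)
    (f (y + s) - f (y - s)).
Proof.
move=> cf s0.
pose c := y - s - 2; pose F u := \int[mu]_(t in `[c, u]) f t.
have dF u : c < u -> is_derive u 1 F (f u).
  move=> cu; have [||dFu Fu] := @continuous_FTC1_closed _ f c u (u + 1) _ _ cu (cf u).
  - by rewrite ltrDl.
  - exact: integrable_itv.
  - by apply: DeriveDef; [exact: dFu|rewrite -derive1E].
have d1 : is_derive (y + s) 1 F (f (y + s)) by apply: dF; rewrite /c; lra.
have d2 : is_derive (y - s) 1 F (f (y - s)) by apply: dF; rewrite /c; lra.
apply: (@near_eq_is_derive _ _ _ (fun t => F (t + s) - F (t - s))).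
  near=> t.
  have : y - 1 < t by near: t; apply: lt_nbhsr; rewrite gtrBl.
  move=> ty; rewrite (@Rintegral_itv_sub f c)// /c; lra.
have e1 : is_derive y 1 (fun t : R => t + s) 1.
  by apply: is_derive_eq; rewrite addr0.
have e2 : is_derive y 1 (fun t : R => t - s) 1.
  by apply: is_derive_eq; rewrite oppr0 addr0.
have c1 : is_derive y 1 (F \o (fun t : R => t + s)) (f (y + s)).
  by rewrite -[f _]mulr1; apply: is_derive1_comp.
have c2 : is_derive y 1 (F \o (fun t : R => t - s)) (f (y - s)).
  by rewrite -[f _]mulr1; apply: is_derive1_comp.
exact: is_deriveB.
Unshelve. all: by end_near. Qed.

(** Continuity of a parameter-dependent integral over a segment, by uniformity
    of the continuity over the compact segment. *)
Lemma continuous_Rintegral_param (T : topologicalType) (k : T -> R -> R) (c d : R) (t0 : T) :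
  (forall t, continuous (k t)) ->
  (forall x, {for (t0, x), continuous (fun z : T * R => k z.1 z.2)}) ->
  {for t0, continuous (fun t => \int[mu]_(x in `[c, d]) k t x)}.
Proof.
move=> ck ck0; apply/cvgrPdist_le => /= e e0.
have [dc|cd] := ltP d c.
  near=> t; rewrite set_itv_ge ?bnd_simp -?ltNge// !Rintegral_set0 subrr normr0.
  exact: ltW.
pose e' := e / (d - c + 1).
have e'0 : 0 < e' by rewrite divr_gt0//; lra.
have tube : \forall t \near t0, `[c, d]%classic `<=` [set x | `|k t0 x - k t x| <= e'].
  have /compact_near_coveringP := @segment_compact R c d; apply => x _.
  have e'20 : 0 < e' / 2 by rewrite divr_gt0.
  have /cvgrPdist_lt/(_ _ e'20) := ck0 x.
  rewrite /= => -[[U V] /= [Ut0 Vx] UV].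
  exists (V, U) => //= -[x' t] /= [Vx' Ut].
  have h1 := UV (t, x') (conj Ut Vx').
  have h2 := UV (t0, x') (conj (nbhs_singleton Ut0) Vx').
  rewrite /= in h1 h2.
  rewrite (_ : k t0 x' - k t x' = (k t0 x - k t x') - (k t0 x - k t0 x')); last ring.
  by apply: le_trans (ler_normB _ _) _; lra.
near=> t.
have kt : `[c, d]%classic `<=` [set x | `|k t0 x - k t x| <= e'] by near: t.
rewrite -RintegralB//; [|exact: integrable_itv..].
have icd : mu.-integrable `[c, d] (EFin \o (fun x => k t0 x - k t x)).
  by apply: integrable_itv => x; apply: continuousB; exact: ck.
apply: le_trans (le_normr_Rintegral _ icd) _ => //.
apply: (@le_trans _ _ (\int[mu]_(x in `[c, d]) e')).
  apply: le_Rintegral; [exact: measurable_itv| | |by move=> x; exact: kt].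
  - apply: integrable_itv => x.
    apply: (@continuous_comp _ _ _ (fun x => k t0 x - k t x) Num.norm).
      by apply: continuousB; exact: ck.
    exact: norm_continuous.
  - by apply: integrable_itv => x; exact: cvg_cst.
rewrite Rintegral_cst; last exact: measurable_itv.
rewrite [X in fine X](lebesgue_measure_itv `[c, d])/=; case: ifPn => [_|_ /=]; last by rewrite mulr0 ltW.
rewrite /= /e' -mulrA ler_piMr ?(ltW e0)// mulrC.
by rewrite ler_pdivrMr; lra.
Unshelve. all: by end_near. Qed.

End moving_disk.

Section moving_disk_C1.
Context {R : realType}.
Local Notation mu := (@lebesgue_measure R).
Implicit Types (p q : R * R) (g h : R * R -> R).

Lemma Rintegral_support (A B : set R) (f : R -> R) :
  A `<=` B -> (forall x, B x -> ~ A x -> f x = 0) ->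
  \int[mu]_(x in A) f x = \int[mu]_(x in B) f x.
Proof.
move=> AB f0; rewrite Rintegral_mkcond [RHS]Rintegral_mkcond.
apply: eq_Rintegral => x _; rewrite /patch; case: ifPn => [|]; rewrite ?inE.
  by move=> /AB Bx; rewrite mem_set.
by move=> /negP; rewrite inE => Ax; case: ifPn => //; rewrite inE => Bx; rewrite f0.
Qed.

Lemma hchord_le p r x : 0 <= r -> hchord p r x <= r.
Proof.
move=> r0; rewrite /hchord -[leRHS](ger0_norm r0) -sqrtr_sqr ler_wsqrtr//.
by rewrite lerBlDr lerDl sqr_ge0.
Qed.

Lemma hchord_out p r x : 0 <= r -> x \notin `[p.1 - r, p.1 + r] ->
  r ^+ 2 - (x - p.1) ^+ 2 <= 0.
Proof.
move=> r0; rewrite subr_le0 -[(x - _) ^+ 2]real_normK ?num_real//.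
rewrite ler_pXn2r ?nnegrE// => xr; rewrite leNgt; apply: contra xr.
by rewrite ltr_norml in_itv/= => /andP[? ?]; apply/andP; split; lra.
Qed.

Lemma continuous_hchord r (z : (R * R) * R) :
  {for z, continuous (fun z : (R * R) * R => hchord z.1 r z.2)}.
Proof.
apply: (@continuous_comp _ _ _ (fun z : (R * R) * R => r ^+ 2 - (z.2 - z.1.1) ^+ 2)
  Num.sqrt); last exact: sqrt_continuous.
apply: continuousB; first exact: cvg_cst.
apply: (@continuous_comp _ _ _ (fun z : (R * R) * R => z.2 - z.1.1) (fun x => x ^+ 2));
  last exact: exprn_continuous.
apply: continuousB; first exact: cvg_snd.
by apply: (@continuous_comp _ _ _ fst fst); exact: cvg_fst.
Qed.

(** Difference of the values of [g] at the endpoints of the vertical chord of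
    abscissa [x]; its integral is the derivative of the disk integral of [g]
    when the centre moves vertically. *)
Definition chord_gap p r g x : R :=
  g (x, p.2 + hchord p r x) - g (x, p.2 - hchord p r x).

Lemma continuous_chord_gap r g (z : (R * R) * R) : continuous g ->
  {for z, continuous (fun z : (R * R) * R => chord_gap z.1 r g z.2)}.
Proof.
move=> cg.
have c2 : {for z, continuous (fun z : (R * R) * R => z.1.2)}.
  by apply: (@continuous_comp _ _ _ fst snd); [exact: cvg_fst|exact: cvg_snd].
apply: continuousB.
- apply: (@continuous_comp _ _ _
    (fun z : (R * R) * R => (z.2, z.1.2 + hchord z.1 r z.2)) g); last exact: cg.
  apply: continuous_pair_pt; first exact: cvg_snd.
  by apply: continuousD => //; exact: continuous_hchord.
- apply: (@continuous_comp _ _ _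
    (fun z : (R * R) * R => (z.2, z.1.2 - hchord z.1 r z.2)) g); last exact: cg.
  apply: continuous_pair_pt; first exact: cvg_snd.
  by apply: continuousB => //; exact: continuous_hchord.
Qed.

Lemma continuous_chord_gap2 p r g : continuous g -> continuous (chord_gap p r g).
Proof.
move=> cg x; apply: (@continuous_comp _ _ _ (fun x => (p, x))
  (fun z : (R * R) * R => chord_gap z.1 r g z.2)); last exact: continuous_chord_gap.
by apply: continuous_pair_pt; [exact: cvg_cst|exact: cvg_id].
Qed.

(** Derivative of [dskint p r g] when [p] moves vertically; the chords outside
    the disk are degenerate and do not contribute. *)
Definition dskint_dy r g p : R :=
  \int[mu]_(x in `[p.1 - r, p.1 + r]) chord_gap p r g x.

Lemma chord_gap_out p r g x : 0 <= r -> x \notin `[p.1 - r, p.1 + r] ->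
  chord_gap p r g x = 0.
Proof.
move=> r0 /(hchord_out r0) x0; rewrite /chord_gap /hchord ler0_sqrtr//.
by rewrite subr0 addr0 subrr.
Qed.

Lemma continuous_dskint_dy r g : 0 <= r -> continuous g -> continuous (dskint_dy r g).
Proof.
move=> r0 cg p.
pose F q := \int[mu]_(x in `[p.1 - r - 1, p.1 + r + 1]) chord_gap q r g x.
have cF : {for p, continuous F} := @continuous_Rintegral_param _ _ (fun p => chord_gap p r g)
  (p.1 - r - 1) (p.1 + r + 1) p (fun q => @continuous_chord_gap2 q r g cg)
  (fun x => @continuous_chord_gap r g (p, x) cg).
have E q : `|q.1 - p.1| <= 1 -> dskint_dy r g q = F q.
  rewrite ler_norml => /andP[q1 q2]; apply: Rintegral_support.
    move=> x /=; rewrite !in_itv/= => /andP[? ?]; apply/andP; split; lra.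
  by move=> x _ /= /negP; exact: chord_gap_out.
have Ep : dskint_dy r g p = F p by apply: E; rewrite subrr normr0.
rewrite /continuous_at Ep; apply: cvg_trans cF; apply: near_eq_cvg.
near=> q; rewrite -E//.
rewrite distrC; near: q.
exact: ((cvgrPdist_le (fun q => q.1) _).1 (continuous_fst_pt (q:=p)) 1 ltr01).
Unshelve. all: by end_near. Qed.

Lemma is_derive_dskint_snd r g p : 0 <= r -> continuous g ->
  is_derive p.2 1 (fun y => dskint (p.1, y) r g) (dskint_dy r g p).
Proof.
move=> r0 cg.
pose B : set R := `[p.1 - r, p.1 + r]%classic.
pose f y x := chordint (p.1, y) r g x.
have FE : (fun y => dskint (p.1, y) r g) = (fun y => \int[mu]_(x in B) f y x).
  apply/funext => y; have [_ ->] := @slice _ (p.1, y) r g r0 cg.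
  symmetry; apply: Rintegral_support => // x _ /= /negP xB.
  by apply: chordint_eq0; apply: hchord_out.
have df (y x : R) : is_derive y 1 (f ^~ x) (chord_gap (p.1, y) r g x).
  exact: (is_derive_chord _ (continuous_section (x := x) cg) (hchord_ge0 p r x)).
have mB : measurable (B : set (measurableTypeR R)) by exact: measurable_itv.
have [M M0 gM] := @continuous_bounded_box _ g p (r + 1) cg.
have Iy : [set` `]p.2 - 1, p.2 + 1[] p.2.
  by rewrite /= in_itv/=; apply/andP; split; lra.
have intf y : [set` `]p.2 - 1, p.2 + 1[] y -> mu.-integrable B (EFin \o f y).
  move=> _; apply: integrableS (@slice _ (p.1, y) r g r0 cg).1 => //.
have derf y x : [set` `]p.2 - 1, p.2 + 1[] y -> B x -> derivable (f ^~ x) y 1.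
  by move=> _ _; have [] := df y x.
have G0 : forall x : R, 0 <= cst (M + M) x by move=> x; rewrite addr_ge0.
have intG : mu.-integrable B (EFin \o cst (M + M)).
  by apply: integrable_itv => x; exact: cvg_cst.
have Gub y x : [set` `]p.2 - 1, p.2 + 1[] y -> B x ->
    `|partial1of2 f y x| <= cst (M + M) x.
  rewrite /= in_itv/= => /andP[y1 y2] xB; rewrite partial1of2E.
  have [_ ->] := df y x; apply: le_trans (ler_normB _ _) _.
  have s0 := hchord_ge0 (p.1, y) r x; have sr := hchord_le (p.1, y) x r0.
  move: xB; rewrite /B/= in_itv/= => /andP[x1 x2].
  by apply: lerD; apply: gM; split; rewrite /= in_itv/=; apply/andP; split; lra.
rewrite FE; apply: DeriveDef.
  exact: (derivable_under_integral mB Iy intf derf G0 intG Gub).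
rewrite -derive1E (differentiation_under_integral mB Iy intf derf G0 intG Gub).
apply: eq_Rintegral => x _; rewrite partial1of2E.
by have [_ ->] := df p.2 x; case: (p).
Qed.

(** [g] has the continuous partial derivatives [gx] and [gy] on [U]. *)
Definition has_partials (U : set (R * R)) g gx gy :=
  forall q, U q ->
    [/\ is_derive q.1 1 (fun x => g (x, q.2)) (gx q),
        is_derive q.2 1 (fun y => g (q.1, y)) (gy q),
        {for q, continuous gx} & {for q, continuous gy}].

Lemma dskint_has_partials r g : 0 < r -> continuous g ->
  exists gx gy, has_partials setT (fun p => dskint p r g) gx gy.
Proof.
move=> r0 cg; have r0' := ltW r0.
have cgs : continuous (g \o swap).
  by move=> q; apply: continuous_comp; [exact: continuous_swap|exact: cg].
exists (dskint_dy r (g \o swap) \o swap), (dskint_dy r g) => q _; split.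
- have := @is_derive_dskint_snd r _ (swap q) r0' cgs.
  set F := fun y => _; set G := fun x => _.
  suff -> : F = G by [].
  by apply/funext => x; rewrite /F /G [RHS]dskint_swap.
- exact: is_derive_dskint_snd.
- apply: continuous_comp; first exact: continuous_swap.
  exact: continuous_dskint_dy.
- exact: continuous_dskint_dy.
Qed.

(** The area of a disk does not depend on its centre. *)
Lemma dskint_cst_center r p q (c : R) : 0 <= r ->
  dskint p r (cst c) = dskint q r (cst c).
Proof.
move=> r0.
have cc : continuous (cst c : R * R -> R) by move=> ?; exact: cvg_cst.
have E x y y' : dskint (x, y) r (cst c) = dskint (x, y') r (cst c).
  have [_ ->] := @slice _ (x, y) r _ r0 cc.
  have [_ ->] := @slice _ (x, y') r _ r0 cc.
  apply: eq_Rintegral => t _; rewrite /chordint /hchord/=.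
  rewrite !Rintegral_cst; try exact: measurable_itv.
  congr (_ * fine _); set s := Num.sqrt _.
  rewrite [LHS](lebesgue_measure_itv `[y - s, y + s]).
  rewrite [RHS](lebesgue_measure_itv `[y' - s, y' + s])/= !lte_fin.
  have [s0|s0] := ltP 0 s.
    rewrite !ifT; [|lra..].
    by congr EFin; lra.
  by rewrite !ifF//; apply/negbTE; rewrite -leNgt; lra.
case: p q => x y [x' y'].
rewrite (E x y 0) (E x' y' 0) (@dskint_swap _ (x, 0))// [RHS]dskint_swap//.
exact: E.
Qed.

End moving_disk_C1.

(** * Mean values of Cauchy-Riemann pairs *)

Section continuity_at.
Context {R : realType} (T : topologicalType) (t : T).
Implicit Types (f k : T -> R).

Lemma cont_cst (c : R) : {for t, continuous (fun _ : T => c)}.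
Proof. exact: cvg_cst. Qed.

Lemma contD f k : {for t, continuous f} -> {for t, continuous k} ->
  {for t, continuous (fun s => f s + k s)}.
Proof. exact: continuousD. Qed.

Lemma contN f : {for t, continuous f} -> {for t, continuous (fun s => - f s)}.
Proof. exact: continuousN. Qed.

Lemma contM f k : {for t, continuous f} -> {for t, continuous k} ->
  {for t, continuous (fun s => f s * k s)}.
Proof. exact: continuousM. Qed.

Lemma contX f n : {for t, continuous f} -> {for t, continuous (fun s => f s ^+ n)}.
Proof.
move=> cf; apply: (@continuous_comp _ _ _ f (fun x => x ^+ n)) => //.
exact: exprn_continuous.
Qed.

End continuity_at.

Section tent.
Context {R : realType}.
Implicit Types (p q : R * R).

(** [tent p r] is the quadratic function which vanishes on the circle. *)
Definition tent p (r : R) q : R := r ^+ 2 - sqdist p q.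

Lemma cont_tent p r q : {for q, continuous (tent p r)}.
Proof. by apply: contD; [exact: cont_cst|apply: contN; exact: continuous_sqdist]. Qed.

End tent.

(* Syntax-directed proof of the continuity at a point of an expression in
   [+], [-], [*], [^+]. *)
Ltac cont := cbv beta; lazymatch goal with |- context [continuous_at _ ?F] =>
  lazymatch F with
  | (fun _ => ?c) => refine (@cont_cst _ _ _ c)
  | (fun s => @GRing.add _ (@?f s) (@?k s)) => refine (@contD _ _ _ f k _ _); cont
  | (fun s => @GRing.opp _ (@?f s)) => refine (@contN _ _ _ f _); cont
  | (fun s => @GRing.mul _ (@?f s) (@?k s)) => refine (@contM _ _ _ f k _ _); cont
  | (fun s => @GRing.exp _ (@?f s) ?n) => refine (@contX _ _ _ f n _); cont
  | (fun s => s.1) => exact: continuous_fst_pt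
  | (fun s => s.2) => exact: continuous_snd_pt
  | (fun s => tent ?p ?r s) => exact: cont_tent
  | tent ?p ?r => exact: cont_tent
  | (fun s => sqdist ?p s) => exact: continuous_sqdist
  | _ => try assumption
  end end.

Section mean_value.
Context {R : realType}.
Implicit Types (p q : R * R) (a b u v g h : R * R -> R).

Lemma deriveD1 (f g : R -> R) (x df dg : R) :
  is_derive x 1 f df -> is_derive x 1 g dg ->
  is_derive x 1 (fun t => f t + g t) (df + dg).
Proof. by move=> ? ?; exact: is_deriveD. Qed.

Lemma deriveN1 (f : R -> R) (x df : R) :
  is_derive x 1 f df -> is_derive x 1 (fun t => - f t) (- df).
Proof. by move=> ?; exact: is_deriveN. Qed.

Lemma deriveM1 (f g : R -> R) (x df dg : R) :
  is_derive x 1 f df -> is_derive x 1 g dg ->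
  is_derive x 1 (fun t => f t * g t) (df * g x + f x * dg).
Proof.
move=> fx gx; apply: (is_derive_eq (is_deriveM fx gx)).
by rewrite /GRing.scale/=; ring.
Qed.

Lemma deriveX1 (f : R -> R) (x df : R) n : is_derive x 1 f df ->
  is_derive x 1 (fun t => f t ^+ n.+1) (n.+1%:R * f x ^+ n * df).
Proof.
move=> fx; elim: n => [|n IHn]; first by rewrite expr0 !mul1r.
rewrite (_ : (fun t => _) = (fun t => f t * f t ^+ n.+1)); last first.
  by apply/funext => t; rewrite exprS.
apply: (is_derive_eq (deriveM1 fx IHn)).
by rewrite exprS -(natr1 n.+1); ring.
Qed.

Lemma derive_cst1 (c x : R) : is_derive x 1 (fun=> c) (0 : R).
Proof. exact: is_derive_cst. Qed.

Lemma derive_id1 (x : R) : is_derive x 1 (fun t : R => t) (1 : R).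
Proof. exact: is_derive_id. Qed.

Lemma cont_sub (U V : set (R * R)) g : V `<=` U -> cont_on U g -> cont_on V g.
Proof. by move=> VU cg q /VU /cg. Qed.

Lemma derive_tent_fst p r q :
  is_derive q.1 1 (fun x => tent p r (x, q.2)) (- (2 * (q.1 - p.1))).
Proof.
rewrite /tent /sqdist /=.
by apply: is_derive_eq; rewrite /GRing.scale/=; ring.
Qed.

Lemma derive_tent_snd p r q :
  is_derive q.2 1 (fun y => tent p r (q.1, y)) (- (2 * (q.2 - p.2))).
Proof.
rewrite /tent /sqdist /=.
by apply: is_derive_eq; rewrite /GRing.scale/=; ring.
Qed.

(** [a + i b] satisfies the Cauchy-Riemann equations on [U]; its complex
    derivative is [u - i v]. *)
Definition CR_pair (U : set (R * R)) a b :=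
  [/\ cont_on U a, cont_on U b &
   exists u v, has_partials U a u v /\ has_partials U b (fun q => - v q) u].

(** Multiplication of [a + i b] by [- i]. *)
Lemma CR_pair_rot U a b : CR_pair U a b -> CR_pair U b (fun q => - a q).
Proof.
move=> [ca cb [u [v [da db]]]]; split=> //.
  by move=> q Uq; apply: contN; exact: ca.
exists (fun q => - v q), u; split=> // q /[dup] Uq /da[dx dy cu cv]; split.
- exact: deriveN1.
- exact: deriveN1.
- by apply: contN.
- by apply: contN.
Qed.

Lemma CR_pair_cst U (c d : R) : CR_pair U (cst c) (cst d).
Proof.
split; [by move=> q _; exact: cont_cst..|].
exists (cst 0), (cst 0); split => q _; split;
  rewrite /cst/= ?oppr0; by [exact: derive_cst1|exact: cont_cst].
Qed.

Lemma CR_pairD U a b c d : CR_pair U a b -> CR_pair U c d ->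
  CR_pair U (fun q => a q + c q) (fun q => b q + d q).
Proof.
move=> [ca cb [u [v [da db]]]] [cc cd [w [z [dc dd]]]]; split.
- by move=> q Uq; apply: contD; [exact: ca|exact: cc].
- by move=> q Uq; apply: contD; [exact: cb|exact: cd].
exists (fun q => u q + w q), (fun q => v q + z q); split => q Uq.
- have [? ? ? ?] := da _ Uq; have [? ? ? ?] := dc _ Uq.
  by split; by [exact: deriveD1|exact: contD].
- have [_ _ _ ?] := da _ Uq; have [_ _ _ ?] := dc _ Uq.
  have [? ? ? ?] := db _ Uq; have [? ? ? ?] := dd _ Uq.
  split; [|exact: deriveD1| |exact: contD].
  + by rewrite opprD; exact: deriveD1.
  + by apply: contN; exact: contD.
Qed.

(** The mean of [(zeta - z) f(zeta)] over a disk centred at [z] vanishes, since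
    [(zeta - z) f] is the derivative with respect to the conjugate variable of
    [- (r^2 - |zeta - z|^2) f]. *)
Lemma CR_pair_moment p r a b : 0 < r -> CR_pair (cdsk p r) a b ->
  dskint p r (fun q => (q.1 - p.1) * a q - (q.2 - p.2) * b q) = 0.
Proof.
move=> r0 [ca cb [u [v [da db]]]].
pose gx q := - (2 * (q.1 - p.1)) * a q + tent p r q * u q.
pose gy q := - (- (2 * (q.2 - p.2)) * b q + tent p r q * u q).
have cgx : cont_on (cdsk p r) gx.
  move=> q pq; have := ca _ pq; have [_ _ ? ?] := da _ pq; rewrite /gx => ?; cont.
have cgy : cont_on (cdsk p r) gy.
  move=> q pq; have := cb _ pq; have [_ _ ? ?] := db _ pq; rewrite /gy => ?; cont.
have Ix : dskint p r gx = 0.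
  apply: (@dskint_deriv_fst _ _ _ (fun q => tent p r q * a q) _ r0 cgx).
    move=> q pq; have [ax ? ? ?] := da _ pq.
    apply: (is_derive_eq (deriveM1 (derive_tent_fst p r q) ax)).
    by rewrite -!surjective_pairing.
  by move=> q pq; rewrite /tent pq subrr mul0r.
have Iy : dskint p r gy = 0.
  apply: (@dskint_deriv_snd _ _ _ (fun q => - (tent p r q * b q)) _ r0 cgy).
    move=> q pq; have [? by_ ? ?] := db _ pq.
    apply: (is_derive_eq (deriveN1 (deriveM1 (derive_tent_snd p r q) by_))).
    by rewrite -!surjective_pairing.
  by move=> q pq; rewrite /tent pq subrr mul0r oppr0.
have : dskint p r (fun q => gx q + gy q) = 0 by rewrite (dskintD r0 cgx cgy) Ix Iy addr0.
rewrite (@eq_dskint _ _ _ _ (fun q => (-2) * ((q.1 - p.1) * a q - (q.2 - p.2) * b q))).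
  rewrite dskintZ//; first by move=> /eqP; rewrite mulf_eq0 oppr_eq0 pnatr_eq0/= => /eqP.
  by move=> q pq; have := ca _ pq; have := cb _ pq => ? ?; cont.
by move=> q _; rewrite /gx /gy; ring.
Qed.

(** The means of [f] with respect to the weights
    [(n + 1) (1 - |zeta - z|^2 / r^2)^n] do not depend on [n]. *)
Lemma CR_pair_weight p r a b n : 0 < r -> CR_pair (cdsk p r) a b ->
  n.+1%:R * dskint p r (fun q => tent p r q ^+ n * a q) = r ^+ 2 ^+ n * dskint p r a.
Proof.
move=> r0 [ca cb [u [v [da db]]]].
elim: n => [|n IHn].
  by rewrite expr0 !mul1r; apply: eq_dskint => q _; rewrite expr0 mul1r.
pose T := tent p r.
(* [gx + gy] is twice the real part of the derivative of [T^(n+1) conj(w) f] with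
   respect to the conjugate variable, where [w = zeta - z]. *)
pose gx q := n.+1%:R * T q ^+ n * - (2 * (q.1 - p.1)) *
   ((q.1 - p.1) * a q + (q.2 - p.2) * b q) +
   T q ^+ n.+1 * (a q + (q.1 - p.1) * u q - (q.2 - p.2) * v q).
pose gy q := n.+1%:R * T q ^+ n * - (2 * (q.2 - p.2)) *
   ((q.2 - p.2) * a q - (q.1 - p.1) * b q) +
   T q ^+ n.+1 * (a q + (q.2 - p.2) * v q - (q.1 - p.1) * u q).
have cgx : cont_on (cdsk p r) gx.
  move=> q pq; have := ca _ pq; have := cb _ pq; have [_ _ ? ?] := da _ pq.
  by rewrite /gx /T => ? ?; cont.
have cgy : cont_on (cdsk p r) gy.
  move=> q pq; have := ca _ pq; have := cb _ pq; have [_ _ ? ?] := da _ pq.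
  by rewrite /gy /T => ? ?; cont.
have dX q : is_derive q.1 1 (fun x : R => x - p.1) (1 + 0).
  exact: (deriveD1 (derive_id1 _) (derive_cst1 _ _)).
have dY q : is_derive q.2 1 (fun x : R => x - p.2) (1 + 0).
  exact: (deriveD1 (derive_id1 _) (derive_cst1 _ _)).
have Ix : dskint p r gx = 0.
  apply: (@dskint_deriv_fst _ _ _
    (fun q => T q ^+ n.+1 * ((q.1 - p.1) * a q + (q.2 - p.2) * b q)) _ r0 cgx).
    move=> q pq; have [ax _ _ _] := da _ pq; have [bx _ _ _] := db _ pq.
    rewrite /T /=; apply: (is_derive_eq (deriveM1 (deriveX1 n (derive_tent_fst p r q))
      (deriveD1 (deriveM1 (dX q) ax) (deriveM1 (derive_cst1 _ _) bx)))).
    by rewrite /gx /T -!surjective_pairing; ring.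
  by move=> q pq; rewrite /T /tent pq subrr expr0n mul0r.
have Iy : dskint p r gy = 0.
  apply: (@dskint_deriv_snd _ _ _
    (fun q => T q ^+ n.+1 * ((q.2 - p.2) * a q - (q.1 - p.1) * b q)) _ r0 cgy).
    move=> q pq; have [_ ay _ _] := da _ pq; have [_ by_ _ _] := db _ pq.
    rewrite /T /=; apply: (is_derive_eq (deriveM1 (deriveX1 n (derive_tent_snd p r q))
      (deriveD1 (deriveM1 (dY q) ay) (deriveN1 (deriveM1 (derive_cst1 _ _) by_))))).
    by rewrite /gy /T -!surjective_pairing; ring.
  by move=> q pq; rewrite /T /tent pq subrr expr0n mul0r.
have cT m : cont_on (cdsk p r) (fun q => T q ^+ m * a q).
  by move=> q pq; have := ca _ pq => ?; rewrite /T; cont.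
have : dskint p r (fun q => gx q + gy q) = 0 by rewrite (dskintD r0 cgx cgy) Ix Iy addr0.
rewrite (@eq_dskint _ _ _ _ (fun q => 2 * n.+2%:R * (T q ^+ n.+1 * a q) -
    2 * r ^+ 2 * n.+1%:R * (T q ^+ n * a q))); last first.
  move=> q _; have -> : r ^+ 2 = T q + ((q.1 - p.1) ^+ 2 + (q.2 - p.2) ^+ 2).
    by rewrite /T /tent /sqdist; ring.
  rewrite /gx /gy exprS -(natr1 n.+1); move: n.+1%:R (T q ^+ n) (T q) => N S Tq.
  by ring.
rewrite dskintB//; last 2 first.
- by move=> q pq; apply: contM; [exact: cont_cst|exact: cT].
- by move=> q pq; apply: contM; [exact: cont_cst|exact: cT].
rewrite (dskintZ _ r0 (cT n.+1)) (dskintZ _ r0 (cT n)).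
move=> /subr0_eq E; apply: (@mulfI _ 2); first by rewrite pnatr_eq0.
transitivity (2 * r ^+ 2 * (n.+1%:R * dskint p r (fun q => tent p r q ^+ n * a q))).
  by rewrite mulrA E [RHS]mulrA.
by rewrite IHn (exprS (r ^+ 2)); move: (_ ^+ n) (dskint _ _ _) => P A; ring.
Qed.

Lemma continuous_sqdist_near p g e : {for p, continuous g} -> 0 < e ->
  exists2 d, 0 < d & forall q, sqdist p q < d ^+ 2 -> `|g q - g p| < e.
Proof.
move=> cg e0; have /cvgrPdist_lt/(_ e e0) := cg.
rewrite -/(nbhs p _) => /nbhs_ballP[d /= d0 H]; exists d => // q pq.
have [q1 q2] : `|q.1 - p.1| < d /\ `|q.2 - p.2| < d.
  split; rewrite -(@ltr_pXn2r _ 2) ?nnegrE ?(ltW d0)// real_normK ?num_real//.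
    by apply: le_lt_trans pq; rewrite lerDl sqr_ge0.
  by apply: le_lt_trans pq; rewrite lerDr sqr_ge0.
rewrite distrC; apply: H; split; rewrite /ball/= distrC//.
Qed.

(** Area of the disk; expressed as an integral, it enters the identities
    between disk integrals without its value [pi r^2] being needed. *)
Definition disk_area p (r : R) := dskint p r (cst 1).

(** The mean value property.  With [c = a - a(p)] and [|c| <= e + K |zeta - p|^2]
    on the disk, the weighted integrals of [|c|] are bounded by the area times
    [e + K r^2 / (n + 2)], for every [n]. *)
Lemma CR_pair_mean p r a b : 0 < r -> CR_pair (cdsk p r) a b ->
  dskint p r a = disk_area p r * a p.
Proof.
move=> r0 CRab; have [ca cb _] := CRab.
have pp : cdsk p r p by rewrite /cdsk/= /sqdist !subrr expr0n addr0 sqr_ge0.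
have c1 : cont_on (cdsk p r) (cst 1) by move=> q _; exact: cont_cst.
pose A := disk_area p r.
have A0 : 0 <= A.
  by rewrite /A /disk_area /dskint; apply: Rintegral_ge0 => q _; exact: ler01.
pose c q := a q + - a p.
have CRc : CR_pair (cdsk p r) c (fun q => b q + 0).
  exact: (CR_pairD CRab (CR_pair_cst _ (- a p) 0)).
have [cc _ _] := CRc.
suff : dskint p r c = 0.
  rewrite (@eq_dskint _ _ _ _ (fun q => a q - a p * cst 1 q)); last first.
    by move=> q _; rewrite /c /= mulr1.
  rewrite dskintB//; last by move=> q _; exact: cont_cst.
  by rewrite dskintZ// => /subr0_eq ->; rewrite mulrC.
have [h ch hc] := continuous_extension r0 cc.
have [M M0 hM] := @continuous_bounded_box _ h p r ch.
apply/eqP; rewrite -normr_le0; apply/ler_addgt0Pr => e e0; rewrite add0r.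
pose e1 := e / (2 * (A + 1)).
have e10 : 0 < e1 by rewrite divr_gt0// mulr_gt0// ltr_wpDl.
have [d d0 dP] := continuous_sqdist_near (ca _ pp) e10.
pose K := M / d ^+ 2.
have K0 : 0 <= K by rewrite divr_ge0// sqr_ge0.
have cK q : cdsk p r q -> `|c q| <= e1 + K * sqdist p q.
  move=> pq; have [qd|dq] := ltP (sqdist p q) (d ^+ 2).
    by rewrite (le_trans (ltW (dP _ qd)))// lerDl mulr_ge0// sqdist_ge0.
  apply: (@le_trans _ _ M).
    by rewrite -hc//; apply: hM; exact: (cdsk_box (ltW r0)).
  apply: (@le_trans _ _ (K * sqdist p q)); last by rewrite lerDr ltW.
  by rewrite /K mulrAC ler_pdivlMr ?exprn_gt0// ler_wpM2l.
have W n : n.+1%:R * dskint p r (fun q => tent p r q ^+ n) = r ^+ 2 ^+ n * A.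
  rewrite -(@CR_pair_weight _ _ _ (cst 0))//; last exact: CR_pair_cst.
  by congr (_ * _); apply: eq_dskint => q _; rewrite mulr1.
have cT n : cont_on (cdsk p r) (fun q => tent p r q ^+ n) by move=> q pq; cont.
have bound n : `|dskint p r c| <= A * (e1 + K * (r ^+ 2 / n.+2%:R)).
  have rn0 : 0 < r ^+ 2 ^+ n by rewrite !exprn_gt0.
  rewrite -(ler_pM2l rn0) -[X in X * `|_|]gtr0_norm// -normrM.
  rewrite -(CR_pair_weight _ r0 CRc) normrM ger0_norm//.
  have -> : r ^+ 2 ^+ n * (A * (e1 + K * (r ^+ 2 / n.+2%:R))) =
    n.+1%:R * dskint p r (fun q => (e1 + K * r ^+ 2) * tent p r q ^+ n -
        K * tent p r q ^+ n.+1).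
    rewrite dskintB//; last 2 first.
    - by move=> q pq; apply: contM; [exact: cont_cst|exact: (cT n q)].
    - by move=> q pq; apply: contM; [exact: cont_cst|exact: (cT n.+1 q)].
    rewrite dskintZ// dskintZ//.
    have := W n; have := W n.+1.
    move: (dskint p r (fun q => tent p r q ^+ n.+1)) => I1.
    move: (dskint p r (fun q => tent p r q ^+ n)) => I0.
    move=> E1 E0; have -> : I1 = r ^+ 2 ^+ n.+1 * A / n.+2%:R.
      by rewrite -E1 mulrAC divff ?mul1r// pnatr_eq0.
    have -> : I0 = r ^+ 2 ^+ n * A / n.+1%:R.
      by rewrite -E0 mulrAC divff ?mul1r// pnatr_eq0.
    rewrite (exprS (r ^+ 2)) -(natr1 n.+1) -(natr1 n).
    have : (n%:R + 1 != 0 :> R) /\ (n%:R + 1 + 1 != 0 :> R).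
      by rewrite !natr1 !pnatr_eq0.
    move: (n%:R : R) (r ^+ 2 ^+ n) (r ^+ 2) => N P Q [N1 N2]; field.
    by rewrite N1 N2.
  rewrite ler_pM2l ?ltr0n//; apply: le_norm_dskint => //.
  - by move=> q pq; have := cc _ pq => ?; cont.
  - by move=> q pq; cont.
  - move=> q pq; have T0 : 0 <= tent p r q by rewrite subr_ge0 ltW.
    rewrite normrM ger0_norm ?exprn_ge0//.
    apply: le_trans (ler_wpM2l _ (cK _ (dsk_cdsk pq))) _; first exact: exprn_ge0.
    have -> : sqdist p q = r ^+ 2 - tent p r q by rewrite /tent; ring.
    by rewrite (exprS (tent p r q)) le_eqVlt; apply/orP; left; apply/eqP; ring.
have [n nK] : exists n : nat, K * r ^+ 2 / e1 < n%:R.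
  by exists (Num.truncn (K * r ^+ 2 / e1)).+1; rewrite truncnS_gt.
apply: le_trans (bound n) _.
apply: (@le_trans _ _ (A * (e1 + e1))).
  rewrite ler_wpM2l// lerD2l mulrA ler_pdivrMr ?ltr0n//.
  move: nK; rewrite ltr_pdivrMr// => /ltW/le_trans; apply.
  by rewrite mulrC ler_pM2l// ler_nat -addn2 leq_addr.
rewrite /e1 -mulr2n -[_ *+ 2]mulr_natl invfM !mulrA.
have -> : A * 2 * e * 2^-1 * (A + 1)^-1 = A / (A + 1) * e by field; lra.
by rewrite ler_piMl ?(ltW e0)// ler_pdivrMr; lra.
Qed.

End mean_value.

(** * From the mean value formula to the Cauchy-Riemann equations *)

Section converse.
Context {R : realType}.
Local Notation mu2 := (@area_measure R).
Local Notation R2 := (measurableTypeR R * measurableTypeR R)%type.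
Implicit Types (p q : R * R) (a b u v g h : R * R -> R).

(** Mean value theorem with endpoints in either order. *)
Lemma mean_value_unordered (f f' : R -> R) (a b : R) :
  (forall x, `|x - a| <= `|b - a| -> is_derive x 1 f (f' x)) ->
  exists2 c, `|c - a| <= `|b - a| & f b - f a = f' c * (b - a).
Proof.
move=> df; have [ab|ba|<-] := ltgtP a b; last first.
- by exists a => //; rewrite !subrr mulr0.
- have d x : x \in `[b, a] -> is_derive x 1 f (f' x).
    rewrite in_itv/= => /andP[? ?]; apply: df.
    by rewrite !ler0_norm ?subr_le0// ?(ltW ba)//; lra.
  have dO x (xab : x \in `]b, a[) := d x (subset_itv_oo_cc xab).
  have cO : {within `[b, a], continuous f}.
    by apply: derivable_within_continuous => x xab; have [] := d x xab.
  have [c cba E] := MVT_segment (ltW ba) dO cO.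
  exists c; last by rewrite -opprB E; ring.
  move: cba; rewrite in_itv/= => /andP[? ?].
  by rewrite !ler0_norm ?subr_le0// ?(ltW ba)//; lra.
- have d x : x \in `[a, b] -> is_derive x 1 f (f' x).
    rewrite in_itv/= => /andP[? ?]; apply: df.
    by rewrite !ger0_norm ?subr_ge0// ?(ltW ab)//; lra.
  have dO x (xab : x \in `]a, b[) := d x (subset_itv_oo_cc xab).
  have cO : {within `[a, b], continuous f}.
    by apply: derivable_within_continuous => x xab; have [] := d x xab.
  have [c cba E] := MVT_segment (ltW ab) dO cO.
  exists c => //.
  move: cba; rewrite in_itv/= => /andP[? ?].
  by rewrite !ger0_norm ?subr_ge0// ?(ltW ab)//; lra.
Qed.

(** [g] is differentiable at [p], with partial derivatives [alpha], [beta]. *)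
Definition total_diff g p (alpha beta : R) :=
  forall e, 0 < e -> exists2 d, 0 < d & forall q, sqdist p q < d ^+ 2 ->
    `|g q - (g p + alpha * (q.1 - p.1) + beta * (q.2 - p.2))| <=
      e * (`|q.1 - p.1| + `|q.2 - p.2|).

Lemma sqdist_le p q (x y : R) : `|x - p.1| <= `|q.1 - p.1| -> `|y - p.2| <= `|q.2 - p.2| ->
  sqdist p (x, y) <= sqdist p q.
Proof.
move=> xq yq; rewrite /sqdist /= -[(x - _) ^+ 2]real_normK ?num_real//.
rewrite -[(y - _) ^+ 2]real_normK ?num_real// -[(q.1 - _) ^+ 2]real_normK ?num_real//.
by rewrite -[(q.2 - _) ^+ 2]real_normK ?num_real// lerD// ler_pXn2r ?nnegrE.
Qed.

Lemma dsk_center p r : 0 < r -> dsk p r p.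
Proof. by move=> r0; rewrite /dsk/= /sqdist !subrr expr0n addr0 exprn_gt0. Qed.

Lemma has_partials_total_diff p r g gx gy : 0 < r ->
  has_partials (dsk p r) g gx gy -> total_diff g p (gx p) (gy p).
Proof.
move=> r0 dg e e0; have [_ _ cx cy] := dg _ (dsk_center p r0).
have [d1 d10 H1] := continuous_sqdist_near cx e0.
have [d2 d20 H2] := continuous_sqdist_near cy e0.
pose d := Num.min r (Num.min d1 d2).
have d0 : 0 < d by rewrite !lt_min r0 d10.
exists d => // q pq.
have lt_sq t s : d <= s -> t < d ^+ 2 -> t < s ^+ 2.
  by move=> ds /lt_le_trans; apply; rewrite ler_pXn2r ?nnegrE ?(ltW d0)// (le_trans (ltW d0)).
have dr : d <= r by rewrite ge_min lexx.
have dd1 : d <= d1 by rewrite !ge_min lexx orbT.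
have dd2 : d <= d2 by rewrite !ge_min lexx !orbT.
have dgx x : `|x - p.1| <= `|q.1 - p.1| ->
    is_derive x 1 (fun x => g (x, q.2)) (gx (x, q.2)).
  move=> xq; have xp : dsk p r (x, q.2).
    by apply: (lt_sq _ _ dr); apply: le_lt_trans pq; exact: sqdist_le.
  by have [] := dg _ xp.
have [x xq Ex] := mean_value_unordered dgx.
have dgy y : `|y - p.2| <= `|q.2 - p.2| ->
    is_derive y 1 (fun y => g (p.1, y)) (gy (p.1, y)).
  move=> yq; have yp : dsk p r (p.1, y).
    apply: (lt_sq _ _ dr); apply: le_lt_trans pq; apply: sqdist_le => //.
    by rewrite subrr normr0.
  by have [] := dg _ yp.
have [y yq Ey] := mean_value_unordered dgy.
have hx : `|gx (x, q.2) - gx p| <= e.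
  by apply/ltW/H1/(lt_sq _ _ dd1); apply: le_lt_trans pq; exact: sqdist_le.
have hy : `|gy (p.1, y) - gy p| <= e.
  apply/ltW/H2/(lt_sq _ _ dd2); apply: le_lt_trans pq; apply: sqdist_le => //.
  by rewrite subrr normr0.
have -> : g q - (g p + gx p * (q.1 - p.1) + gy p * (q.2 - p.2)) =
    (gx (x, q.2) - gx p) * (q.1 - p.1) + (gy (p.1, y) - gy p) * (q.2 - p.2).
  move: Ex Ey; rewrite -!surjective_pairing => Ex Ey.
  have -> : g q = g (p.1, q.2) + gx (x, q.2) * (q.1 - p.1) by rewrite -Ex; ring.
  have -> : g (p.1, q.2) = g p + gy (p.1, y) * (q.2 - p.2) by rewrite -Ey; ring.
  by ring.
apply: le_trans (ler_normD _ _) _; rewrite !normrM mulrDr.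
by apply: lerD; exact: ler_wpM2r.
Qed.

Lemma disk_area_gt0 p r : 0 < r -> 0 < disk_area p r.
Proof.
move=> r0; rewrite /disk_area /dskint Rintegral_cst ?mul1r; last exact: measurable_dsk.
(* an open square contained in the disk *)
pose B : set R2 := `]p.1 - r / 2, p.1 + r / 2[%classic `*` `]p.2 - r / 2, p.2 + r / 2[%classic.
have BE : mu2 B = (r * r)%:E.
  rewrite /area_measure/= product_measure1E; try exact: measurable_itv.
  rewrite [X in (X * _)%E](lebesgue_measure_itv `]p.1 - r / 2, p.1 + r / 2[).
  rewrite [X in (_ * X)%E](lebesgue_measure_itv `]p.2 - r / 2, p.2 + r / 2[)/=.
  rewrite !lte_fin !ifT; [|lra..].
  by rewrite -!EFinD -EFinM; congr EFin; field.
rewrite fine_gt0// area_dsk_lty ?(ltW r0)// andbT.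
apply: (@lt_le_trans _ _ (mu2 B)); first by rewrite BE lte_fin mulr_gt0.
apply: le_measure; rewrite ?inE; [by apply: measurableX; exact: measurable_itv|exact: measurable_dsk|].
move=> q [] /=; rewrite !in_itv/= => /andP[x1 x2] /andP[y1 y2].
rewrite /dsk/= /sqdist.
have X2 : (q.1 - p.1) ^+ 2 < (r / 2) ^+ 2.
  rewrite -[_ ^+ 2]real_normK ?num_real// ltr_pXn2r ?nnegrE ?divr_ge0 ?(ltW r0)//.
  by rewrite ltr_norml; apply/andP; split; lra.
have Y2 : (q.2 - p.2) ^+ 2 < (r / 2) ^+ 2.
  rewrite -[_ ^+ 2]real_normK ?num_real// ltr_pXn2r ?nnegrE ?divr_ge0 ?(ltW r0)//.
  by rewrite ltr_norml; apply/andP; split; lra.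
have : (r / 2) ^+ 2 + (r / 2) ^+ 2 <= r ^+ 2 by have := sqr_ge0 r; rewrite expr_div_n; lra.
lra.
Qed.

(** Real part of the integrand of the mean value formula for [a + i b]. *)
Definition mean_integrand p (r : R) a b q : R :=
  a q + 2 / r * ((q.1 - p.1) * a q - (q.2 - p.2) * b q).

(** The mean value formula for [a + i b] at [p], in its real part; its imaginary
    part is the real part of the formula for [- i (a + i b) = b - i a]. *)
Definition mean_formula p r a b :=
  disk_area p r * a p = dskint p r (mean_integrand p r a b).

Lemma cont_mean_integrand p r U a b : cont_on U a -> cont_on U b ->
  cont_on U (mean_integrand p r a b).
Proof.
by move=> ca cb q Uq; have := ca _ Uq; have := cb _ Uq => ? ?; rewrite /mean_integrand; cont.
Qed.

Lemma dskint_mean_integrand p r a b : 0 < r -> cont_on (cdsk p r) a ->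
  cont_on (cdsk p r) b ->
  dskint p r (mean_integrand p r a b) = dskint p r a +
    2 / r * dskint p r (fun q => (q.1 - p.1) * a q - (q.2 - p.2) * b q).
Proof.
move=> r0 ca cb.
have c1 : cont_on (cdsk p r) (fun q => (q.1 - p.1) * a q - (q.2 - p.2) * b q).
  by move=> q pq; have := ca _ pq; have := cb _ pq => ? ?; cont.
rewrite -(dskintZ _ r0 c1) -(dskintD r0 ca)//.
by move=> q pq; have := c1 _ pq => ?; apply: contM => //; exact: cont_cst.
Qed.

Lemma CR_pair_mean_formula p r a b : 0 < r -> CR_pair (cdsk p r) a b ->
  mean_formula p r a b.
Proof.
move=> r0 CRab; have [ca cb _] := CRab.
rewrite /mean_formula (dskint_mean_integrand r0 ca cb).
by rewrite (CR_pair_moment r0 CRab) mulr0 addr0 (CR_pair_mean r0 CRab).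
Qed.

Lemma CR_pair_linear U p (c c' m n : R) :
  CR_pair U (fun q => c + m * (q.1 - p.1) - n * (q.2 - p.2))
            (fun q => c' + n * (q.1 - p.1) + m * (q.2 - p.2)).
Proof.
have dlin0 (k s x : R) : is_derive x 1 (fun t => k * (t - s)) k.
  apply: (is_derive_eq (deriveM1 (derive_cst1 k x)
    (deriveD1 (derive_id1 x) (derive_cst1 (- s) x)))).
  by ring.
have dlin (e k s x : R) : is_derive x 1 (fun t => e + k * (t - s)) k.
  by apply: (is_derive_eq (deriveD1 (derive_cst1 e x) (dlin0 k s x))); rewrite add0r.
split; [by move=> q _; cont..|].
exists (cst m), (cst (- n)); split => q _; split; try exact: cont_cst.
- apply: (is_derive_eq (deriveD1 (dlin c m p.1 q.1)
    (derive_cst1 (- (n * (q.2 - p.2))) q.1))).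
  by rewrite addr0.
- apply: (is_derive_eq (deriveD1 (derive_cst1 (c + m * (q.1 - p.1)) q.2)
    (deriveN1 (dlin0 n p.2 q.2)))).
  by rewrite add0r.
- apply: (is_derive_eq (deriveD1 (dlin c' n p.1 q.1)
    (derive_cst1 (m * (q.2 - p.2)) q.1))).
  by rewrite addr0 /cst opprK.
- apply: (is_derive_eq (deriveD1 (derive_cst1 (c' + n * (q.1 - p.1)) q.2)
    (dlin0 m p.2 q.2))).
  by rewrite add0r.
Qed.

Lemma dskint_sqdist p r : 0 < r ->
  dskint p r (sqdist p) = r ^+ 2 / 2 * disk_area p r.
Proof.
move=> r0.
have := @CR_pair_weight _ p r (cst 1) (cst 0) 1 r0 (CR_pair_cst _ _ _).
have c1 : cont_on (cdsk p r) (fun q => r ^+ 2 * cst 1 q) by move=> q _; exact: cont_cst.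
have c2 : cont_on (cdsk p r) (sqdist p) by move=> q _; exact: continuous_sqdist.
rewrite (@eq_dskint _ _ _ _ (fun q => r ^+ 2 * cst 1 q - sqdist p q)); last first.
  by move=> q _; rewrite /tent expr1 /=; ring.
rewrite (dskintB r0 c1 c2) dskintZ//; last by move=> q _; exact: cont_cst.
by rewrite -/(disk_area p r) expr1; move: (disk_area _ _) (dskint _ _ _) => A B; lra.
Qed.

(** If [f = a + i b] is differentiable at [z] and has the mean value formula
    there for small radii then [Re (df/dzbar) = 0]: the holomorphic part of the
    linearisation of [f] satisfies the formula, and the antiholomorphic part
    contributes a nonzero term of order [r]. *)
Lemma mean_formula_CR p d a b (al be ga de : R) : 0 < d ->
  cont_on (cdsk p d) a -> cont_on (cdsk p d) b ->
  (forall r, 0 < r -> r <= d -> mean_formula p r a b) ->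
  total_diff a p al be -> total_diff b p ga de -> al = de.
Proof.
move=> d0 ca cb H da db.
(* [k + i l] is the derivative of [f] with respect to the conjugate variable. *)
pose k := (al - de) / 2; pose l := (be + ga) / 2.
suff : k = 0 by rewrite /k => k0; lra.
apply/eqP; rewrite -normr_le0; apply/ler_addgt0Pr => e e0; rewrite add0r.
pose e1 := e / 10.
have e10 : 0 < e1 by rewrite divr_gt0.
have [r1 r10 Ha] := da _ e10; have [r2 r20 Hb] := db _ e10.
pose r := Num.min d (Num.min r1 r2).
have r0 : 0 < r by rewrite !lt_min d0 r10.
have lt_sq t s : r <= s -> t < r ^+ 2 -> t < s ^+ 2.
  by move=> ds /lt_le_trans; apply; rewrite ler_pXn2r ?nnegrE ?(ltW r0)// (le_trans (ltW r0)).
have rd : r <= d by rewrite ge_min lexx.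
have rr1 : r <= r1 by rewrite !ge_min lexx orbT.
have rr2 : r <= r2 by rewrite !ge_min lexx !orbT.
have sub : cdsk p r `<=` cdsk p d.
  by move=> q /le_trans; apply; rewrite ler_pXn2r ?nnegrE ?(ltW r0)// (ltW d0).
have ca' := cont_sub sub ca; have cb' := cont_sub sub cb.
(* [ha + i hb] is the holomorphic part of the linearisation, [Ra + i Rb] the
   remainder, and [N] the contribution of the antiholomorphic part. *)
pose ha q := a p + (al - k) * (q.1 - p.1) - (l - be) * (q.2 - p.2).
pose hb q := b p + (l - be) * (q.1 - p.1) + (al - k) * (q.2 - p.2).
have CRh : CR_pair (cdsk p r) ha hb by exact: CR_pair_linear.
have [cha chb _] := CRh.
pose Ra q := a q - (a p + al * (q.1 - p.1) + be * (q.2 - p.2)).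
pose Rb q := b q - (b p + ga * (q.1 - p.1) + de * (q.2 - p.2)).
have cRa : cont_on (cdsk p r) Ra.
  by move=> q pq; have := ca' _ pq => ?; rewrite /Ra; cont.
have cRb : cont_on (cdsk p r) Rb.
  by move=> q pq; have := cb' _ pq => ?; rewrite /Rb; cont.
pose N q := k * (q.1 - p.1) + l * (q.2 - p.2) + 2 / r * k * sqdist p q.
have cN : cont_on (cdsk p r) N by move=> q pq; rewrite /N; cont.
pose A := disk_area p r.
have A0 : 0 < A by exact: disk_area_gt0.
have IX : dskint p r (fun q => q.1 - p.1) = 0.
  rewrite -[RHS](CR_pair_moment r0 (CR_pair_cst (cdsk p r) 1 0)).
  by apply: eq_dskint => q _ /=; ring.
have IY : dskint p r (fun q => q.2 - p.2) = 0.
  rewrite -[RHS](CR_pair_moment r0 (CR_pair_cst (cdsk p r) 0 (-1))).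
  by apply: eq_dskint => q _ /=; ring.
have cX : cont_on (cdsk p r) (fun q => q.1 - p.1) by move=> q pq; cont.
have cY : cont_on (cdsk p r) (fun q => q.2 - p.2) by move=> q pq; cont.
have cS : cont_on (cdsk p r) (sqdist p) by move=> q _; exact: continuous_sqdist.
have IN : dskint p r N = r * k * A.
  rewrite /N dskintD//; last 2 first.
  - by move=> q pq; cont.
  - by move=> q pq; cont.
  rewrite dskintD//; last 2 first.
  - by move=> q pq; cont.
  - by move=> q pq; cont.
  rewrite (dskintZ _ r0 cX) (dskintZ _ r0 cY) (dskintZ _ r0 cS) IX IY dskint_sqdist//.
  by rewrite -/A; field; rewrite gt_eqF.
have cM := @cont_mean_integrand p r _ _ _ cRa cRb.
have cMh := @cont_mean_integrand p r _ _ _ cha chb.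
have : A * a p = A * a p + r * k * A + dskint p r (mean_integrand p r Ra Rb).
  have -> : A * a p = dskint p r (mean_integrand p r ha hb).
    rewrite -(CR_pair_mean_formula r0 CRh) /A; congr (_ * _).
    by rewrite /ha !subrr !mulr0 addr0 subr0.
  transitivity (dskint p r (mean_integrand p r a b)).
    rewrite -(H r r0 rd) -(CR_pair_mean_formula r0 CRh) /A; congr (_ * _).
    by rewrite /ha !subrr !mulr0 addr0 subr0.
  rewrite -IN -dskintD// -dskintD//; last first.
    by move=> q pq; have := cMh _ pq; have := cN _ pq => ? ?; exact: contD.
  apply: eq_dskint => q _.
  rewrite /mean_integrand /ha /hb /Ra /Rb /N /sqdist /k /l.
  by field; rewrite gt_eqF.
have bnd : `|dskint p r (mean_integrand p r Ra Rb)| <= 10 * e1 * r * A.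
  have cc : cont_on (cdsk p r) (fun q => 10 * e1 * r * cst 1 q).
    by move=> q _; exact: cont_cst.
  rewrite -[X in _ <= X](_ : dskint p r (fun q => 10 * e1 * r * cst 1 q) = _); last first.
    by rewrite dskintZ// => q _; exact: cont_cst.
  apply: le_norm_dskint => // q pq.
  have [xr yr] := cdsk_bound (ltW r0) (dsk_cdsk pq).
  have xy : e1 * (`|q.1 - p.1| + `|q.2 - p.2|) <= e1 * (r + r).
    by rewrite ler_pM2l// lerD.
  have ra := le_trans (Ha q (lt_sq _ _ rr1 pq)) xy.
  have rb := le_trans (Hb q (lt_sq _ _ rr2 pq)) xy.
  rewrite -/(Ra q) in ra; rewrite -/(Rb q) in rb.
  rewrite /= mulr1 /mean_integrand; apply: le_trans (ler_normD _ _) _.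
  rewrite normrM (gtr0_norm (divr_gt0 (ltr0n _ 2) r0)).
  have : `|(q.1 - p.1) * Ra q - (q.2 - p.2) * Rb q| <= r * (e1 * (r + r)) + r * (e1 * (r + r)).
    apply: le_trans (ler_normB _ _) _; rewrite !normrM.
    by apply: lerD; apply: ler_pM.
  move=> /(ler_wpM2l (ltW (divr_gt0 (ltr0n _ 2) r0))).
  have -> : 2 / r * (r * (e1 * (r + r)) + r * (e1 * (r + r))) = 8 * (e1 * r).
    by field; rewrite gt_eqF.
  by move: (2 / r * _) => ?; move: ra; rewrite mulrDr -(mulrA 10); lra.
move=> E; have {}E : dskint p r (mean_integrand p r Ra Rb) = - (k * (r * A)).
  by move: E; rewrite -mulrA; lra.
move: bnd; rewrite E normrN normrM (gtr0_norm (mulr_gt0 r0 A0)) -[10 * e1 * r * A]mulrA.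
rewrite ler_pM2r ?mulr_gt0// => /le_trans; apply.
by rewrite /e1; lra.
Qed.

(** ** Regularity *)

Lemma near_section U q : open U -> U q ->
  (\forall x \near q.1, U (x, q.2)) /\ (\forall y \near q.2, U (q.1, y)).
Proof.
move=> oU Uq.
have nU : nbhs (q.1, q.2) U by rewrite -surjective_pairing; exact: open_nbhs_nbhs.
have c1 : {for q.1, continuous (fun x => (x, q.2))}.
  by apply: continuous_pair_pt; [exact: cvg_id|exact: cvg_cst].
have c2 : {for q.2, continuous (fun y => (q.1, y))}.
  by apply: continuous_pair_pt; [exact: cvg_cst|exact: cvg_id].
by split; [exact: (c1 _ nU)|exact: (c2 _ nU)].
Qed.

Lemma has_partials_eq U g h gx gy : open U -> (forall q, U q -> g q = h q) ->
  has_partials U g gx gy -> has_partials U h gx gy.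
Proof.
move=> oU gh dg q Uq; have [dx dy cx cy] := dg _ Uq.
have [n1 n2] := near_section oU Uq; split => //.
- by apply: near_eq_is_derive dx; near=> x; apply: gh; near: x.
- by apply: near_eq_is_derive dy; near=> y; apply: gh; near: y.
Unshelve. all: by end_near. Qed.

Lemma has_partials_sub U V g gx gy : V `<=` U ->
  has_partials U g gx gy -> has_partials V g gx gy.
Proof. by move=> VU dg q /VU /dg. Qed.

Lemma has_partials_cst U (c : R) : has_partials U (cst c) (cst 0) (cst 0).
Proof.
by move=> q _; split; [exact: derive_cst1|exact: derive_cst1|exact: cont_cst|exact: cont_cst].
Qed.

Lemma has_partials_fst U : has_partials U (fun q => q.1) (cst 1) (cst 0).
Proof.
by move=> q _; split; [exact: derive_id1|exact: derive_cst1|exact: cont_cst|exact: cont_cst].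
Qed.

Lemma has_partials_snd U : has_partials U (fun q => q.2) (cst 0) (cst 1).
Proof.
by move=> q _; split; [exact: derive_cst1|exact: derive_id1|exact: cont_cst|exact: cont_cst].
Qed.

Lemma has_partialsD U g gx gy h hx hy :
  has_partials U g gx gy -> has_partials U h hx hy ->
  has_partials U (fun q => g q + h q) (fun q => gx q + hx q) (fun q => gy q + hy q).
Proof.
move=> dg dh q Uq; have [g1 g2 g3 g4] := dg _ Uq; have [h1 h2 h3 h4] := dh _ Uq.
by split; [exact: deriveD1 g1 h1|exact: deriveD1 g2 h2|exact: contD|exact: contD].
Qed.

Lemma has_partialsM U g gx gy h hx hy : cont_on U g -> cont_on U h ->
  has_partials U g gx gy -> has_partials U h hx hy ->
  has_partials U (fun q => g q * h q) (fun q => gx q * h q + g q * hx q)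
    (fun q => gy q * h q + g q * hy q).
Proof.
move=> cg ch dg dh q Uq; have [g1 g2 g3 g4] := dg _ Uq; have [h1 h2 h3 h4] := dh _ Uq.
have cgq := cg _ Uq; have chq := ch _ Uq; split; [| |cont|cont].
- by apply: (is_derive_eq (deriveM1 g1 h1)); rewrite -!surjective_pairing.
- by apply: (is_derive_eq (deriveM1 g2 h2)); rewrite -!surjective_pairing.
Qed.

Lemma nbhs_dsk p d : 0 < d -> nbhs p (dsk p d).
Proof. by move=> d0; apply: open_nbhs_nbhs; split; [exact: open_dsk|exact: dsk_center]. Qed.

Lemma nbhs_cdsk_sub p U : nbhs p U -> exists2 r, 0 < r & cdsk p r `<=` U.
Proof.
move=> /nbhs_ballP[d /= d0 H]; exists (d / 2) => [|q]; first by rewrite divr_gt0.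
have d20 : 0 <= d / 2 by rewrite divr_ge0 ?(ltW d0).
move=> /(cdsk_bound d20)[q1 q2]; apply: H; split; rewrite /ball/= distrC; lra.
Qed.

Lemma total_diff_cont g p (al be : R) : total_diff g p al be -> {for p, continuous g}.
Proof.
move=> dg; have [d d0 H] := dg 1 ltr01.
pose L q := g p + al * (q.1 - p.1) + be * (q.2 - p.2).
pose E q := 1 * (`|q.1 - p.1| + `|q.2 - p.2|).
have cL : {for p, continuous L} by rewrite /L; cont.
have cE : {for p, continuous E}.
  rewrite /E; apply: contM; first exact: cont_cst; apply: contD.
    by apply: (@continuous_comp _ _ _ (fun q : R * R => q.1 - p.1) Num.norm);
      [cont|exact: norm_continuous].
  by apply: (@continuous_comp _ _ _ (fun q : R * R => q.2 - p.2) Num.norm);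
    [cont|exact: norm_continuous].
have Ep : E p = 0 by rewrite /E !subrr normr0 addr0 mulr0.
have Lp : L p = g p by rewrite /L !subrr !mulr0 !addr0.
have dp := nbhs_dsk p d0.
apply/cvgrPdist_le => e e0; have e20 : 0 < e / 2 by rewrite divr_gt0.
near=> q.
have h1 : `|L p - L q| <= e / 2 by near: q; exact: ((cvgrPdist_le _ _).1 cL).
have h2 : `|E p - E q| <= e / 2 by near: q; exact: ((cvgrPdist_le _ _).1 cE).
have h3 : dsk p d q by near: q.
rewrite (_ : g p - g q = (L p - L q) - (g q - L q)); last by rewrite Lp; ring.
apply: le_trans (ler_normB _ _) _; rewrite [e]splitr lerD//.
apply: le_trans (H _ h3) _; apply: le_trans h2.
by rewrite Ep sub0r normrN ler_norm.
Unshelve. all: by end_near. Qed.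

Lemma has_partials_cont U g gx gy : open U -> has_partials U g gx gy -> cont_on U g.
Proof.
move=> oU dg q Uq; have [|r r0 rU] := @nbhs_cdsk_sub q U.
  exact: open_nbhs_nbhs.
apply: total_diff_cont (has_partials_total_diff r0 _).
by apply: has_partials_sub dg => z /dsk_cdsk; exact: rU.
Qed.

Lemma cdsk_sub p q (r : R) : 0 <= r -> dsk p r q -> cdsk q r `<=` cdsk p (3 * r).
Proof.
move=> r0 /dsk_cdsk /(cdsk_bound r0)[q1 q2] z /(cdsk_bound r0)[z1 z2].
have aux (x y t : R) : `|y - x| <= r -> `|t - y| <= r -> (t - x) ^+ 2 <= 4 * r ^+ 2.
  move=> yx ty; have -> : 4 * r ^+ 2 = (r + r) ^+ 2 by ring.
  rewrite -[X in X <= _]real_normK ?num_real// ler_pXn2r ?nnegrE ?addr_ge0//.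
  rewrite (_ : t - x = (t - y) + (y - x)); last ring.
  by apply: le_trans (ler_normD _ _) _; exact: lerD.
have := aux _ _ _ q1 z1; have := aux _ _ _ q2 z2.
by rewrite /cdsk/= /sqdist exprMn; have := sqr_ge0 r; lra.
Qed.

(** Expanded over a disk of fixed radius, the mean value formula expresses [f]
    through integrals over a moving disk of continuous functions. *)
Lemma mean_formula_regular Om a b : open Om -> cont_on Om a -> cont_on Om b ->
  (forall p r, 0 < r -> cdsk p r `<=` Om -> mean_formula p r a b) ->
  forall p, Om p -> exists r gx gy, 0 < r /\ has_partials (dsk p r) a gx gy.
Proof.
move=> oO ca cb H p Op; have [s s0 sO] := nbhs_cdsk_sub (open_nbhs_nbhs (conj oO Op)).
pose r := s / 3; have r0 : 0 < r by rewrite divr_gt0.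
have r3 : 3 * r = s by rewrite /r; field.
have [ha cha Ea] := continuous_extension s0 (cont_sub sO ca).
have [hb chb Eb] := continuous_extension s0 (cont_sub sO cb).
pose m q := q.1 * ha q - q.2 * hb q.
have cm : continuous m by move=> q; have := cha q; have := chb q => ? ?; rewrite /m; cont.
have cdO q : dsk p r q -> cdsk q r `<=` Om.
  by move=> pq z /(cdsk_sub (ltW r0) pq); rewrite r3 => /sO.
have [gax [gay dga]] := dskint_has_partials r0 cha.
have [gbx [gby dgb]] := dskint_has_partials r0 chb.
have [gmx [gmy dgm]] := dskint_has_partials r0 cm.
have oT : open [set: R * R] by exact: openT.
have cIa := has_partials_cont oT dga; have cIb := has_partials_cont oT dgb.
have cIm := has_partials_cont oT dgm.
pose A := disk_area p r; have A0 : 0 < A by exact: disk_area_gt0.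
(* The integrand depends on the centre [q] affinely, with coefficients that
   come out of the integral. *)
pose K q := dskint q r ha + 2 / r * (dskint q r m +
  (-1 * q.1 * dskint q r ha + q.2 * dskint q r hb)).
have [kx [ky dK]] : exists gx gy, has_partials setT (fun q => A^-1 * K q) gx gy.
  have hc c : cont_on setT (fun _ : R * R => c) by move=> q _; exact: cont_cst.
  have h1 : cont_on setT (fun q : R * R => q.1) by move=> q _; exact: continuous_fst_pt.
  have h2 : cont_on setT (fun q : R * R => q.2) by move=> q _; exact: continuous_snd_pt.
  have d1 := has_partialsM (hc (-1)) h1 (has_partials_cst (-1)) (@has_partials_fst setT).
  have c1 := has_partials_cont oT d1.
  have d2 := has_partialsM c1 cIa d1 dga.
  have d3 := has_partialsM h2 cIb (@has_partials_snd setT) dgb.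
  have d4 := has_partialsD dgm (has_partialsD d2 d3).
  have d5 := has_partialsM (hc (2 / r)) (has_partials_cont oT d4) (has_partials_cst (2 / r)) d4.
  have d6 := has_partialsD dga d5.
  have d7 := has_partialsM (hc A^-1) (has_partials_cont oT d6) (has_partials_cst A^-1) d6.
  by do 2 eexists; exact: d7.
exists r, kx, ky; split => //.
have {}dK : has_partials (dsk p r) (fun q => A^-1 * K q) kx ky.
  exact: has_partials_sub dK.
apply: (has_partials_eq (open_dsk (p := p) (r := r)) _ dK) => q pq; have Oq := cdO _ pq.
have cha' : cont_on (cdsk q r) ha by move=> z _; exact: cha.
have chb' : cont_on (cdsk q r) hb by move=> z _; exact: chb.
have := H q r r0 Oq.
rewrite /mean_formula (_ : disk_area q r = A); last exact: dskint_cst_center (ltW r0).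
have -> : dskint q r (mean_integrand q r a b) = K q.
  have qs : dsk q r `<=` cdsk p s.
    by move=> z /dsk_cdsk /(cdsk_sub (ltW r0) pq); rewrite r3.
  rewrite (@eq_dskint _ _ _ _ (mean_integrand q r ha hb)); last first.
    by move=> z /qs zs; rewrite /mean_integrand Ea// Eb.
  rewrite dskint_mean_integrand// /K; congr (_ + _ * _).
  have c1 : cont_on (cdsk q r) (fun z => -1 * q.1 * ha z).
    by move=> z _; have := cha z => ?; cont.
  have c2 : cont_on (cdsk q r) (fun z => q.2 * hb z).
    by move=> z _; have := chb z => ?; cont.
  have c3 : cont_on (cdsk q r) (fun z => -1 * q.1 * ha z + q.2 * hb z).
    by move=> z qz; exact: contD (c1 _ qz) (c2 _ qz).
  have c4 : cont_on (cdsk q r) m by move=> z _; exact: cm.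
  rewrite -(dskintZ _ r0 cha') -(dskintZ _ r0 chb') -(dskintD r0 c1 c2) -(dskintD r0 c4 c3).
  by apply: eq_dskint => z _; rewrite /m; ring.
by move=> E; rewrite -E mulrA mulVf ?mul1r// gt_eqF.
Qed.

End converse.

(** * The complex plane *)

Section bridge.
Context {R : realType}.
Local Open Scope complex_scope.
Local Notation C := (R[i]^o).
Implicit Types (p q : R * R) (z w : C).

(** Inverse of [plane_to_C]. *)
Definition C_to_plane z : R * R := (complex.Re z, complex.Im z).

Lemma C_to_planeK : cancel C_to_plane (@plane_to_C R).
Proof. by case. Qed.

Lemma plane_to_CK : cancel (@plane_to_C R) C_to_plane.
Proof. by case. Qed.

Lemma normC_sqdist z w : `|z - w| = (Num.sqrt (sqdist (C_to_plane z) (C_to_plane w)))%:C.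
Proof.
rewrite normc_def; congr (_%:C); congr Num.sqrt.
by case: z => ? ?; case: w => ? ?; rewrite /sqdist /=; ring.
Qed.

Lemma diskP z (r : R) w : 0 < r ->
  disk z r w <-> sqdist (C_to_plane z) (C_to_plane w) < r ^+ 2.
Proof.
move=> r0; rewrite /disk /ball /= normC_sqdist ltcR.
by rewrite -[in _ < r](gtr0_norm r0) -sqrtr_sqr ltr_sqrt// exprn_gt0.
Qed.

Lemma preimage_disk z (r : R) : 0 < r ->
  @plane_to_C R @^-1` disk z r = dsk (C_to_plane z) r.
Proof.
move=> r0; apply/seteqP; split => q /=.
  by move=> /(diskP _ _ r0); rewrite plane_to_CK.
by move=> zq; apply/(diskP _ _ r0); rewrite plane_to_CK.
Qed.

Lemma gt0_complexE (e : R[i]) : 0 < e -> exists2 d : R, 0 < d & e = d%:C.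
Proof.
by case: e => x y; rewrite ltcE /= => /andP[/eqP -> x0]; exists x.
Qed.

Lemma nbhs_C z (U : set C) : nbhs z U <-> exists2 r : R, 0 < r & disk z r `<=` U.
Proof.
split=> [/nbhs_ballP[e /= /gt0_complexE[r r0 ->] H]|[r r0 H]]; first by exists r.
by apply/nbhs_ballP; exists r%:C => //=; rewrite ltcR.
Qed.

Lemma dnbhs_C (P : C -> Prop) : (\forall h \near (0 : C)^', P h) <->
  exists2 d : R, 0 < d & forall h, disk 0 d h -> h != 0 -> P h.
Proof.
by split=> [/(nbhs_C 0 (fun h => h != 0 -> P h)).1|H]; last exact: (nbhs_C 0 _).2.
Qed.

Lemma continuous_plane_to_C : continuous (@plane_to_C R).
Proof.
move=> p U /nbhs_C[r r0 rU]; apply: filterS (nbhs_dsk p r0) => q pq; apply: rU.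
by apply/(diskP _ _ r0); rewrite !plane_to_CK.
Qed.

Lemma continuous_C_to_plane : continuous C_to_plane.
Proof.
move=> z U /nbhs_cdsk_sub[r r0 rU]; apply/nbhs_C; exists r => // w zw.
by apply: rU; apply: dsk_cdsk; exact/(diskP _ _ r0).
Qed.

Lemma open_preimage (Om : set C) : open Om -> open (@plane_to_C R @^-1` Om).
Proof. by move=> oO; apply: open_comp => // p _; exact: continuous_plane_to_C. Qed.

Lemma closure_disk_sub z (r : R) (Om : set C) : 0 < r ->
  closure (disk z r) `<=` Om <-> cdsk (C_to_plane z) r `<=` @plane_to_C R @^-1` Om.
Proof.
move=> r0; split => H.
  move=> q zq; apply: H => U /nbhs_C[e e0 eU].
  pose d := e / (e + r); have d0 : 0 < d by rewrite divr_gt0// addr_gt0.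
  have dr : d * r < e.
    by rewrite /d mulrAC ltr_pdivrMr ?addr_gt0// mulrDr ltrDr mulr_gt0.
  have d1 : d < 1 by rewrite ltr_pdivrMr ?addr_gt0// mul1r ltrDl.
  (* a point of the open disk on the segment from [q] to the centre *)
  pose w := plane_to_C (q.1 - d * (q.1 - complex.Re z), q.2 - d * (q.2 - complex.Im z)).
  exists w; split.
    apply/(diskP _ _ r0); rewrite /w plane_to_CK.
    apply: (@le_lt_trans _ _ ((1 - d) ^+ 2 * r ^+ 2)).
      have -> : sqdist (C_to_plane z)
         (q.1 - d * (q.1 - complex.Re z), q.2 - d * (q.2 - complex.Im z)) =
         (1 - d) ^+ 2 * sqdist (C_to_plane z) q by rewrite /sqdist /=; ring.
      by rewrite ler_wpM2l ?sqr_ge0.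
    rewrite gtr_pMl ?exprn_gt0// expr_lt1//; first by lra.
    by rewrite subr_ge0 ltW.
  apply: eU; apply/(diskP _ _ e0); rewrite /w !plane_to_CK.
  apply: (@le_lt_trans _ _ ((d * r) ^+ 2)).
    have -> : sqdist q
       (q.1 - d * (q.1 - complex.Re z), q.2 - d * (q.2 - complex.Im z)) =
       d ^+ 2 * sqdist (C_to_plane z) q by rewrite /sqdist /=; ring.
    by rewrite [leRHS]exprMn ler_wpM2l ?sqr_ge0.
  by rewrite ltr_pXn2r ?nnegrE ?(ltW e0)// mulr_ge0 ?ltW.
rewrite closureE; apply: (@subset_trans _ (C_to_plane @^-1` cdsk (C_to_plane z) r)).
  apply: smallest_sub; last by move=> w /(diskP _ _ r0); exact: dsk_cdsk.
  apply: preimage_closed; first by move=> w _; exact: continuous_C_to_plane.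
  apply: (@preimage_closed _ _ (sqdist (C_to_plane z)) [set x | x <= r ^+ 2]).
    by move=> w _; exact: continuous_sqdist.
  exact: closed_le.
by move=> w /H; rewrite /= C_to_planeK.
Qed.

Variables (f : C -> C).
Let a p := complex.Re (f (plane_to_C p)).
Let b p := complex.Im (f (plane_to_C p)).

Lemma cont_on_parts (Om : set C) : open Om -> {within Om, continuous f} ->
  cont_on (@plane_to_C R @^-1` Om) a /\ cont_on (@plane_to_C R @^-1` Om) b.
Proof.
move=> oO; rewrite continuous_open_subspace// => cf.
have c p : Om (plane_to_C p) -> {for p, continuous (C_to_plane \o f \o @plane_to_C R)}.
  move=> Op; apply: continuous_comp; first exact: continuous_plane_to_C.
  apply: continuous_comp; last exact: continuous_C_to_plane.
  by apply: cf; rewrite inE.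
split=> p /c cp.
- exact: (continuous_comp cp (@continuous_fst_pt R _)).
- exact: (continuous_comp cp (@continuous_snd_pt R _)).
Qed.

Lemma Re_Im_le_norm (x : R[i]) (e : R) : `|x| <= e%:C ->
  `|complex.Re x| <= e /\ `|complex.Im x| <= e.
Proof.
rewrite normc_def lecR => H; have e0 := le_trans (sqrtr_ge0 _) H.
by split; apply: le_trans H; rewrite -sqrtr_sqr ler_wsqrtr// (lerDl, lerDr) sqr_ge0.
Qed.

Lemma norm_le_ReIm (x : R[i]) (e : R) :
  `|complex.Re x| + `|complex.Im x| <= e -> `|x| <= e%:C.
Proof.
move=> H; have e0 : 0 <= e by apply: le_trans H; rewrite addr_ge0.
rewrite normc_def lecR -[leRHS](ger0_norm e0) -sqrtr_sqr ler_wsqrtr//.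
rewrite -(real_normK (num_real (complex.Re x))) -(real_normK (num_real (complex.Im x))).
apply: (@le_trans _ _ ((`|complex.Re x| + `|complex.Im x|) ^+ 2)).
  by rewrite sqrrD lerD2r lerDl mulrn_wge0// mulr_ge0.
by rewrite ler_pXn2r ?nnegrE// addr_ge0.
Qed.

(** Complex differentiability amounts to real differentiability of both parts
    with partial derivatives satisfying the Cauchy-Riemann equations. *)
Lemma derivable_total_diff p : derivable f (plane_to_C p) 1 ->
  exists al be, total_diff a p al (- be) /\ total_diff b p be al.
Proof.
set z := plane_to_C p => /cvg_ex[/= L fL].
exists (complex.Re L), (complex.Im L).
(* The two parts are read off an estimate with complex values. *)
suff H e : 0 < e -> exists2 d, 0 < d & forall q, sqdist p q < d ^+ 2 ->
    `|f (plane_to_C q) - f z - L * (plane_to_C q - z)| <=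
    (e * (`|q.1 - p.1| + `|q.2 - p.2|))%:C.
  split => e e0; have [d d0 dP] := H e e0; exists d => // q /dP /Re_Im_le_norm[HR HI].
  - apply: le_trans HR; rewrite /a -/z; move: (f _) (f z) L {fL H dP HI} => [x y] [x' y'] [l m] /=.
    by rewrite le_eqVlt; apply/orP; left; apply/eqP; congr (`|_|); ring.
  - apply: le_trans HI; rewrite /b -/z; move: (f _) (f z) L {fL H dP HR} => [x y] [x' y'] [l m] /=.
    by rewrite le_eqVlt; apply/orP; left; apply/eqP; congr (`|_|); ring.
move=> e0; have eC : 0 < e%:C by rewrite ltcR.
pose P (h : C) := `|L - h^-1 *: (f (h *: (1 : C) + z) - f z)| <= e%:C.
have [d d0 dP] := (dnbhs_C P).1 ((cvgrPdist_le _ _).1 fL _ eC).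
exists d => // q pq.
pose h := plane_to_C q - z.
have [h0|h0] := eqVneq h 0.
  have -> : plane_to_C q = z by apply/eqP; rewrite -subr_eq0 -/h h0.
  by rewrite !subrr mulr0 subrr normr0 lecR mulr_ge0 ?(ltW e0)// addr_ge0.
have dh : disk 0 d h.
  apply/(diskP _ _ d0); apply: le_lt_trans pq; rewrite /h /z /sqdist /= !subr0.
  by [].
have := dP h dh h0; rewrite /P [h *: _]mulr1 /h subrK -/h => Lh.
have -> : f (plane_to_C q) - f z - L * h =
    - ((L - h^-1 *: (f (plane_to_C q) - f z)) * h).
  rewrite mulrBl [h^-1 *: _]mulrC -mulrA mulVf// mulr1; ring.
rewrite normrN normrM; apply: le_trans (ler_wpM2r (normr_ge0 _) Lh) _.
rewrite (rmorphM (real_complex R)); apply: ler_wpM2l; first exact: ltW.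
by apply: norm_le_ReIm; rewrite /h /z.
Qed.

Lemma total_diff_derivable p al be :
  total_diff a p al (- be) -> total_diff b p be al -> derivable f (plane_to_C p) 1.
Proof.
set z := plane_to_C p => da db; pose L : R[i] := al +i* be.
apply/cvg_ex; exists L; apply/cvgrPdist_le => _ /gt0_complexE[e e0 ->].
have e40 : 0 < e / 4 by rewrite divr_gt0.
have [d1 d10 H1] := da _ e40; have [d2 d20 H2] := db _ e40.
pose P (h : C) := `|L - h^-1 *: (f (h *: (1 : C) + z) - f z)| <= e%:C.
apply: ((dnbhs_C P).2 _); exists (Num.min d1 d2).
  by rewrite lt_min d10.
have d0 : 0 < Num.min d1 d2 by rewrite lt_min d10.
move=> h /(diskP _ _ d0) dh h0; rewrite /P [h *: _]mulr1.
pose q := C_to_plane (h + z).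
have pq : sqdist p q = sqdist (C_to_plane 0) (C_to_plane h).
  by rewrite /q /z; case: (h) => x y; rewrite /sqdist /=; ring.
have qE : plane_to_C q = h + z by exact: C_to_planeK.
have dd1 : sqdist p q < d1 ^+ 2.
  rewrite pq; apply: lt_le_trans dh _; rewrite ler_pXn2r ?nnegrE ?(ltW d0) ?(ltW d10)//.
  by rewrite ge_min lexx.
have dd2 : sqdist p q < d2 ^+ 2.
  rewrite pq; apply: lt_le_trans dh _; rewrite ler_pXn2r ?nnegrE ?(ltW d0) ?(ltW d20)//.
  by rewrite ge_min lexx orbT.
have nh : 0 < `|h| by rewrite normr_gt0.
have [m m0 mE] := gt0_complexE nh.
have [x1 x2] : `|q.1 - p.1| <= m /\ `|q.2 - p.2| <= m.
  have [] : `|complex.Re h| <= m /\ `|complex.Im h| <= m by apply: Re_Im_le_norm; rewrite mE.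
  by rewrite /q /z; case: (h) => x y /=; rewrite !addrK.
have hx : e / 4 * (`|q.1 - p.1| + `|q.2 - p.2|) <= e / 4 * (m + m).
  by rewrite ler_pM2l// lerD.
have h1 := le_trans (H1 q dd1) hx; have h2 := le_trans (H2 q dd2) hx.
have main : `|f (h + z) - f z - L * h| <= (e * m)%:C.
  apply: norm_le_ReIm.
  have -> : e * m = e / 4 * (m + m) + e / 4 * (m + m) by field.
  move: h1 h2; rewrite /a /b qE -/z /L.
  have -> : q.1 - p.1 = complex.Re h by rewrite /q /z; case: (h) => x y /=; ring.
  have -> : q.2 - p.2 = complex.Im h by rewrite /q /z; case: (h) => x y /=; ring.
  move: (h) (f z) (f (h + z)) => [s t] [x' y'] [x y] /= g1 g2.
  apply: lerD.
  - by apply: le_trans g1; rewrite le_eqVlt; apply/orP; left; apply/eqP; congr (`|_|); ring.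
  - by apply: le_trans g2; rewrite le_eqVlt; apply/orP; left; apply/eqP; congr (`|_|); ring.
have -> : L - h^-1 *: (f (h + z) - f z) = - (h^-1 * (f (h + z) - f z - L * h)).
  have E (k u l : R[i]) : k != 0 -> l - k^-1 * u = - (k^-1 * (u - l * k)).
    by move=> k0; field.
  exact: E.
rewrite normrN normrM normfV mulrC ler_pdivrMr//; apply: le_trans main _.
by rewrite mE rmorphM.
Qed.

End bridge.

(** * The characterization *)

Section partial_derivatives.
Context {R : realType}.
Implicit Types (p q : R * R) (g : R * R -> R).

(** Directional derivatives along the axes are derivatives of sections. *)
Lemma is_derive_fstP p g (l : R) :
  is_derive p ((1, 0) : R * R) g l <-> is_derive p.1 1 (fun x => g (x, p.2)) l.
Proof.
have E : (fun h : R => h^-1 *: ((g \o shift p) (h *: ((1, 0) : R * R)) - g p)) =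
    (fun h : R => h^-1 *: (((fun x => g (x, p.2)) \o shift p.1) (h *: (1 : R)) - g (p.1, p.2))).
  apply/funext => h; rewrite -surjective_pairing /=.
  rewrite (_ : h *: ((1, 0) : R * R) + p = (h *: (1 : R) + p.1, p.2))//.
  by case: p => x y; congr pair; rewrite /= scaler0 add0r.
have D1 : derivable g p ((1, 0) : R * R) = derivable (fun x => g (x, p.2)) p.1 1 :=
  congr1 (fun k : R -> R => cvg (k @ (0 : R)^')) E.
have D2 : 'D_((1, 0) : R * R) g p = 'D_1 (fun x => g (x, p.2)) p.1 :=
  congr1 (fun k : R -> R => lim (k @ (0 : R)^')) E.
by split=> -[]; [rewrite D1 D2|rewrite -D1 -D2] => ? ?; split.
Qed.

Lemma is_derive_sndP p g (l : R) :
  is_derive p ((0, 1) : R * R) g l <-> is_derive p.2 1 (fun y => g (p.1, y)) l.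
Proof.
have E : (fun h : R => h^-1 *: ((g \o shift p) (h *: ((0, 1) : R * R)) - g p)) =
    (fun h : R => h^-1 *: (((fun y => g (p.1, y)) \o shift p.2) (h *: (1 : R)) - g (p.1, p.2))).
  apply/funext => h; rewrite -surjective_pairing /=.
  rewrite (_ : h *: ((0, 1) : R * R) + p = (p.1, h *: (1 : R) + p.2))//.
  by case: p => x y; congr pair; rewrite /= scaler0 add0r.
have D1 : derivable g p ((0, 1) : R * R) = derivable (fun y => g (p.1, y)) p.2 1 :=
  congr1 (fun k : R -> R => cvg (k @ (0 : R)^')) E.
have D2 : 'D_((0, 1) : R * R) g p = 'D_1 (fun y => g (p.1, y)) p.2 :=
  congr1 (fun k : R -> R => lim (k @ (0 : R)^')) E.
by split=> -[]; [rewrite D1 D2|rewrite -D1 -D2] => ? ?; split.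
Qed.

Lemma is_derive_eps (k : R -> R) (x l : R) :
  (forall e, 0 < e -> exists2 d, 0 < d &
    forall h, `|h| < d -> `|k (h + x) - k x - l * h| <= e * `|h|) ->
  is_derive x 1 k l.
Proof.
move=> H; suff kl : h^-1 *: ((k \o shift x) (h *: (1 : R)) - k x) @[h --> 0^'] --> l.
  apply: DeriveDef; first by apply/cvg_ex; exists l.
  exact: cvg_lim kl.
apply/cvgrPdist_le => e e0; have [d d0 dP] := H e e0.
near=> h.
have h0 : h != 0 by near: h; exact: nbhs_dnbhs_neq.
have hd : `|h| < d by near: h; exact: dnbhs0_lt.
rewrite /= [h *: _]mulr1.
have -> : l - h^-1 *: (k (h + x) - k x) = - (h^-1 * (k (h + x) - k x - l * h)).
  by rewrite /GRing.scale /=; field.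
rewrite normrN normrM normfV mulrC ler_pdivrMr ?normr_gt0//.
exact: dP.
Unshelve. all: by end_near. Qed.

Lemma total_diff_is_derive p g (al be : R) : total_diff g p al be ->
  is_derive p.1 1 (fun x => g (x, p.2)) al /\
  is_derive p.2 1 (fun y => g (p.1, y)) be.
Proof.
move=> dg; split; apply: is_derive_eps => e e0; have [d d0 dP] := dg e e0;
  exists d => // h hd.
- have := dP (h + p.1, p.2); rewrite /sqdist /= -surjective_pairing.
  rewrite addrK subrr expr0n normr0 !addr0 mulr0 addr0 opprD addrA; apply.
  by rewrite -[_ ^+ 2]real_normK ?num_real// ltr_pXn2r ?nnegrE// ltW.
- have := dP (p.1, h + p.2); rewrite /sqdist /= -surjective_pairing.
  rewrite addrK subrr expr0n normr0 !add0r mulr0 addr0 opprD addrA; apply.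
  by rewrite -[_ ^+ 2]real_normK ?num_real// ltr_pXn2r ?nnegrE// ltW.
Qed.

Lemma is_derive_unique (k : R -> R) (x l l' : R) :
  is_derive x 1 k l -> is_derive x 1 k l' -> l = l'.
Proof. by case=> _ <- [_ <-]. Qed.

Lemma C1_plane_has_partials U g : open U -> C1_plane U g ->
  has_partials U g (fun p => 'D_(1, 0) g p) (fun p => 'D_(0, 1) g p).
Proof.
move=> oU C1g q Uq.
have [d1 c1] := C1g (1, 0) (or_introl erefl).
have [d2 c2] := C1g (0, 1) (or_intror erefl).
rewrite continuous_open_subspace// in c1; rewrite continuous_open_subspace// in c2.
split.
- by apply/is_derive_fstP; apply: DeriveDef => //; exact: d1.
- by apply/is_derive_sndP; apply: DeriveDef => //; exact: d2.
- by apply: c1; rewrite inE.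
- by apply: c2; rewrite inE.
Qed.

Lemma has_partials_C1_plane U g : open U ->
  (forall p, U p -> exists r gx gy, 0 < r /\ has_partials (dsk p r) g gx gy) ->
  C1_plane U g.
Proof.
move=> oU H v hv.
have loc p : U p -> exists r k, [/\ 0 < r, {for p, continuous k} &
    forall q, dsk p r q -> is_derive q v g (k q)].
  move=> /H[r [gx [gy [r0 dg]]]]; have [_ _ cx cy] := dg _ (dsk_center p r0).
  case: hv => ->; [exists r, gx|exists r, gy]; split => // q /dg[dx dy _ _].
  - exact/is_derive_fstP.
  - exact/is_derive_sndP.
split.
  move=> p /loc[r [k [r0 _ dk]]]; have [//] := dk _ (dsk_center p r0).
rewrite continuous_open_subspace// => p; rewrite inE => /loc[r [k [r0 ck dk]]].
have kE q : dsk p r q -> k q = 'D_v g q by move=> /dk[_ ->].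
rewrite /continuous_at -(kE _ (dsk_center p r0)).
apply: cvg_trans ck; apply: near_eq_cvg; near=> q; apply: kE.
by near: q; exact: nbhs_dsk.
Unshelve. all: by end_near. Qed.

End partial_derivatives.

Section formula.
Context {R : realType}.
Local Open Scope complex_scope.
Implicit Types (f : R[i]^o -> R[i]^o) (z : R[i]^o).

Lemma area_disk z (r : R) : 0 < r -> area (disk z r) = disk_area (C_to_plane z) r.
Proof.
move=> r0; rewrite /area preimage_disk// /disk_area /dskint Rintegral_cst ?mul1r//.
exact: measurable_dsk.
Qed.

(** The complex formula is the conjunction of its real and imaginary parts. *)
Lemma mean_formulaP f z (r : R) : 0 < r ->
  let a p := complex.Re (f (plane_to_C p)) in
  let b p := complex.Im (f (plane_to_C p)) in
  f z = ((area (disk z r))^-1)%:C *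
    area_integral (disk z r) (fun zeta => f zeta * (1 + (2 / r)%:C * (zeta - z))) <->
  mean_formula (C_to_plane z) r a b /\
  mean_formula (C_to_plane z) r b (fun q => - a q).
Proof.
move=> r0 a b; set p := C_to_plane z.
rewrite /area_integral area_disk// preimage_disk//.
have -> : \int[area_measure R]_(q in dsk p r)
    complex.Re (f (plane_to_C q) * (1 + (2 / r)%:C * (plane_to_C q - z))) =
    dskint p r (mean_integrand p r a b).
  apply: eq_dskint => q _; rewrite /mean_integrand /a /b /p.
  by case: (f _) => x y; case: z {p} => s t /=; ring.
have -> : \int[area_measure R]_(q in dsk p r)
    complex.Im (f (plane_to_C q) * (1 + (2 / r)%:C * (plane_to_C q - z))) =
    dskint p r (mean_integrand p r b (fun q => - a q)).
  apply: eq_dskint => q _; rewrite /mean_integrand /a /b /p.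
  by case: (f _) => x y; case: z {p} => s t /=; ring.
have A0 := disk_area_gt0 p r0; rewrite /mean_formula.
have -> : a p = complex.Re (f z) by rewrite /a C_to_planeK.
have -> : b p = complex.Im (f z) by rewrite /b C_to_planeK.
move: (disk_area p r) A0 (dskint _ _ _) (dskint _ _ _) => A A0 I J.
have A1 : A != 0 by rewrite gt_eqF.
case: (f z) => x y /=; split.
  move=> /eqP; rewrite eq_complex /= => /andP[/eqP -> /eqP ->].
  by rewrite !mul0r subr0 addr0 !mulrA mulfV// !mul1r.
move=> [<- <-]; apply/eqP; rewrite eq_complex /= !mul0r subr0 addr0.
by rewrite !mulrA mulVf// !mul1r !eqxx.
Qed.

End formula.

Local Open Scope complex_scope.

Theorem proposition1p1 (R : realType) (Omega : set R[i]^o)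
    (f : R[i]^o -> R[i]^o) (Omega_domain : domain Omega)
    (f_cont : {within Omega, continuous f}) :
  (C1_in Omega f /\ holomorphic_in Omega f) <->
  (forall (z : R[i]^o) (r : R), 0 < r -> closure (disk z r) `<=` Omega ->
     f z = ((area (disk z r))^-1)%:C *
           area_integral (disk z r)
             (fun zeta => f zeta * (1 + (2 / r)%:C * (zeta - z)))).
Proof.
have [oO _ _] := Omega_domain.
pose Om := @plane_to_C R @^-1` Omega.
have oOm : open Om by exact: open_preimage.
have [ca cb] := cont_on_parts oO f_cont.
set a := fun p => complex.Re _ in ca; set b := fun p => complex.Im _ in cb.
split=> [[[C1a _] hol] z r r0 /(closure_disk_sub _ _ r0) zO|H].
  apply/(mean_formulaP _ _ r0).
  pose u p := 'D_(1, 0) a p; pose v p := 'D_(0, 1) a p.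
  have da : has_partials Om a u v by exact: C1_plane_has_partials.
  (* The Cauchy-Riemann equations give the partial derivatives of [b]. *)
  have db : has_partials Om b (fun q => - v q) u.
    move=> q Oq; have [ax ay cu cv] := da _ Oq.
    have [al [be [ta tb]]] := derivable_total_diff (hol _ Oq).
    have [tax tay] := total_diff_is_derive ta.
    have [tbx tby] := total_diff_is_derive tb.
    rewrite (is_derive_unique ax tax) (is_derive_unique ay tay) opprK.
    by split => //; exact: contN.
  have CRab : CR_pair (cdsk (C_to_plane z) r) a b.
    split; [exact: cont_sub zO ca|exact: cont_sub zO cb|].
    by exists u, v; split; [exact: has_partials_sub zO da|exact: has_partials_sub zO db].
  split; first exact: CR_pair_mean_formula.
  by apply: CR_pair_mean_formula => //; exact: CR_pair_rot.
have Hab p r : 0 < r -> cdsk p r `<=` Om ->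
    mean_formula p r a b /\ mean_formula p r b (fun q => - a q).
  move=> r0 pO; rewrite -[p]plane_to_CK; apply/(mean_formulaP _ _ r0); apply: H => //.
  by apply/(closure_disk_sub _ _ r0); rewrite plane_to_CK.
have cna : cont_on Om (fun q => - a q) by move=> q Oq; apply: contN; exact: ca.
have Ha p r : 0 < r -> cdsk p r `<=` Om -> mean_formula p r a b.
  by move=> r0 pO; have [] := Hab p r r0 pO.
have Hb p r : 0 < r -> cdsk p r `<=` Om -> mean_formula p r b (fun q => - a q).
  by move=> r0 pO; have [] := Hab p r r0 pO.
have ra := mean_formula_regular oOm ca cb Ha.
have rb := mean_formula_regular oOm cb cna Hb.
split; first by split; exact: has_partials_C1_plane.
move=> z Oz; pose p := C_to_plane z.
have Op : Om p by rewrite /Om /= C_to_planeK.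
have [r1 [ax [ay [r10 da]]]] := ra _ Op; have [r2 [bx [by_ [r20 db]]]] := rb _ Op.
have ta := has_partials_total_diff r10 da; have tb := has_partials_total_diff r20 db.
have tna : total_diff (fun q => - a q) p (- ax p) (- ay p).
  move=> e /ta[d d0 dP]; exists d => // q /dP; rewrite -normrN; congr (`|_| <= _).
  by ring.
have [d d0 dO] := nbhs_cdsk_sub (open_nbhs_nbhs (conj oOm Op)).
have small r : r <= d -> 0 < r -> cdsk p r `<=` Om.
  move=> rd r0 q pq; apply: dO; apply: le_trans pq _.
  by rewrite ler_pXn2r ?nnegrE ?(ltW r0) ?(ltW d0).
have CR1 : ax p = by_ p.
  apply: (mean_formula_CR d0 (cont_sub dO ca) (cont_sub dO cb) _ ta tb) => r r0 rd.
  by apply: Ha => //; exact: small.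
have CR2 : bx p = - ay p.
  apply: (mean_formula_CR d0 (cont_sub dO cb) (cont_sub dO cna) _ tb tna) => r r0 rd.
  by apply: Hb => //; exact: small.
rewrite -[z]C_to_planeK; apply: (@total_diff_derivable _ f p (ax p) (bx p)).
  by rewrite CR2 opprK.
by rewrite CR1.
Qed.
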